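(* Let $g\in H^\infty(\mathbb{D})$ be such that $g(\mathbb{D})\cap\mathbb{D}=\varnothing$, $|g|>1$ almost everywhere on $\mathbb{T}$, and $\log(|g|-1)\in L^1(\mathbb{T})$. Then the operator $T_g^*$ on $H^2(\mathbb{D})$ is not $1$-weakly hypercyclic.
   Context: $\mathbb{D}$ is the open unit disk, $\mathbb{T}$ the unit circle with normalized Lebesgue measure; functions in $H^\infty(\mathbb{D})$ are identified with their boundary values on $\mathbb{T}$. $H^2(\mathbb{D})\subseteq L^2(\mathbb{T})$; for $g\in L^\infty(\mathbb{T})$, $T_g=PM_g$ where $M_g$ is multiplication by $g$ and $P$ is the orthogonal projection of $L^2(\mathbb{T})$ onto $H^2(\mathbb{D})$; $T_g^*$ is the Hilbert space adjoint. An operator $T$ on a complex Banach space $X$ is $1$-weakly hypercyclic if there is $x\in X$ such that for every non-zero continuous linear functional $f$ on $X$, the set $\{f(T^mx):m\in\mathbb{Z}_+\}$ is dense in $\mathbb{C}$. *)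

(* Defs.v *)
From HB Require Import structures.
From mathcomp Require Import all_boot all_order all_algebra.
From mathcomp Require Import all_classical all_reals all_analysis.
From mathcomp Require Import complex.
Set Implicit Arguments. Unset Strict Implicit. Unset Printing Implicit Defensive.
Import Order.TTheory GRing.Theory Num.Theory.
Import numFieldNormedType.Exports.
Local Open Scope classical_set_scope.
Local Open Scope ring_scope.

Section Defs.
Variable R : realType.
Local Notation C := R[i].

Definition cabs (z : C) : R := Num.sqrt (complex.Re z ^+ 2 + complex.Im z ^+ 2).

Definition Ccvg (u : nat -> C) (l : C) : Prop :=
  (fun n => cabs (u n - l)) @ \oo --> (0 : R).

Definition expi (t : R) : C := Complex (cos t) (sin t).

Definition psum (a : nat -> C) (z : C) (n : nat) : C :=
  \sum_(k < n) a k * z ^+ k.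

Definition is_Hinf (a : nat -> C) (G : C -> C) : Prop :=
  (forall z, cabs z < 1 -> Ccvg (psum a z) (G z)) /\
  exists M : R, forall z, cabs z < 1 -> cabs (G z) <= M.

Definition is_boundary_value (G : C -> C) (gb : R -> C) : Prop :=
  {ae (@lebesgue_measure R), forall t,
     (fun r : R => cabs (G ((Complex r 0) * expi t) - gb t)) @ at_left 1 --> (0 : R)}.

(* H^2(D), identified with square-summable Taylor coefficient sequences *)
Definition inH2 (c : nat -> C) : Prop :=
  cvgn (series (fun n => cabs (c n) ^+ 2)).

Definition H2norm (c : nat -> C) : R :=
  Num.sqrt (limn (series (fun n => cabs (c n) ^+ 2))).

Definition inner_psum (x y : nat -> C) (n : nat) : C :=
  \sum_(k < n) x k * conjc (y k).

(* The analytic Toeplitz operator T_g = P M_g on H^2: for g in H^oo,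
   P(g f) = g f, whose Taylor coefficients are the Cauchy product. *)
Definition Toep (a : nat -> C) (f : nat -> C) : nat -> C :=
  fun n => \sum_(k < n.+1) a k * f (n - k)%N.

Definition is_adjoint_on_H2 (T A : (nat -> C) -> (nat -> C)) : Prop :=
  (forall h, inH2 h -> inH2 (A h)) /\
  forall f h, inH2 f -> inH2 h ->
    exists s : C, Ccvg (inner_psum (T f) h) s /\ Ccvg (inner_psum f (A h)) s.

Definition nonzero_cont_lin_functional (phi : (nat -> C) -> C) : Prop :=
  (forall x y, inH2 x -> inH2 y -> phi (x + y) = phi x + phi y) /\
  (forall (c : C) x, inH2 x -> phi (fun n => c * x n) = c * phi x) /\
  (forall x0, inH2 x0 -> forall e : R, 0 < e -> exists2 d : R, 0 < d &
     forall x, inH2 x -> H2norm (x - x0) < d -> cabs (phi x - phi x0) < e) /\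
  (exists x, inH2 x /\ phi x <> 0).

Definition denseC (S : set C) : Prop :=
  forall (w : C) (e : R), 0 < e -> exists2 z, S z & cabs (z - w) < e.

Definition one_weakly_hypercyclic_H2 (A : (nat -> C) -> (nat -> C)) : Prop :=
  exists x, inH2 x /\
    forall phi, nonzero_cont_lin_functional phi ->
      denseC [set phi (iter m A x) | m in [set: nat]].

End Defs.

(* Main.v *)
(* It suffices to find, for every [x] in [H2], some [f] with [|<g^m f, x>|] bounded below
   for all [m], since [<T_g^{* m} x, f>] is its conjugate.  The function [b = 1/g] is
   analytic in the disc with [|b| <= 1], and the boundary values of [g] give
   [1 - |b(z)| >= P[psi](z)], where [psi = 1 - 1/|g|] on the circle and [P] denotes the
   Poisson integral.  As [log psi] is integrable, there is an outer function [h] with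
   [|h| <= exp (4 P[log psi]) <= P[psi]^4 <= (1 - |b|)^4] up to a constant; replacing
   [log psi] by its part below a level [-n] makes [h] as close to 1 as we wish, so that
   [<z^j h, x> <> 0] for some [j].  Then [|b^k z^j h|] is [O (k^-4)], which leaves room to
   choose integer digits [t_k < (k+1)(k+2)] such that [f = sum_k t_k b^k z^j h] converges.
   The coefficient of [t_m] in [<g^m f, x>] is the fixed number [<z^j h, x>], so at most
   one value of [t_m] makes this pairing small, and counting shows that all the bad
   values can be avoided simultaneously.

   Limits are taken coefficientwise along an ultrafilter, which spares the extraction of
   subsequences in every compactness (Montel) argument. *)
Require Import Defs.
From HB Require Import structures.
From mathcomp Require Import all_boot all_order all_algebra.
From mathcomp Require Import all_classical all_reals all_analysis.
From mathcomp Require Import measurable_realfun complex.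
From mathcomp Require Import ring lra.
Set Implicit Arguments. Unset Strict Implicit. Unset Printing Implicit Defensive.
Import Order.TTheory GRing.Theory Num.Theory.
Import numFieldNormedType.Exports.
Local Open Scope classical_set_scope.
Local Open Scope ring_scope.

(** * Complex moduli and limits along filters *)

Section ComplexModulus.
Variable R : realType.
Local Notation C := R[i].
Implicit Types z w : C.

(** The vector [f] has to serve every [m] at once. In [<g^m f, x>] the terms with [k < m] carry
    powers of [g] that may grow with [m], and those with [k > m] are unrelated numbers. This is why
    the digits are integers. Two distinct digits differ by at least 1, so two values of [t_m] cannot
    both bring the pairing below half of [|<z^j h, x>|].

    The ranges [(k+1)(k+2)] are chosen because their inverses telescope to a sum below 1, however
    many constraints there are. As they grow like [k^2], a decay [k^-p] with [p > 3] is wanted, and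
    4 is the first such integer. The decay itself comes from the size of the maximum of
    [s^k (1-s)^4] on the unit interval.

    Everything is done on Taylor coefficients. Parseval's identity on circles replaces Cauchy's
    formula for bounding coefficients, and the inverse of [g] and the outer functions are limits of
    explicit combinations of Cauchy products. *)

Lemma normC_cabs z : `|z| = real_complex R (cabs z).
Proof. exact: normc_def. Qed.

Lemma cabs_ge0 z : 0 <= cabs z.
Proof. exact: sqrtr_ge0. Qed.

Lemma cabsM z w : cabs (z * w) = cabs z * cabs w.
Proof. by apply: (@complexI R); rewrite rmorphM /= -!normC_cabs normrM. Qed.

Lemma cabsN z : cabs (- z) = cabs z.
Proof. by apply: (@complexI R); rewrite -!normC_cabs normrN. Qed.

Lemma cabsBC z w : cabs (z - w) = cabs (w - z).
Proof. by rewrite -cabsN opprB. Qed.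

Lemma cabs0 : cabs 0 = 0 :> R.
Proof. by rewrite /cabs /= expr0n /= addr0 sqrtr0. Qed.

Lemma cabs_real (x : R) : cabs (Complex x 0) = `|x|.
Proof. by rewrite /cabs /= expr0n /= addr0 sqrtr_sqr. Qed.

Lemma cabs1 : cabs 1 = 1 :> R.
Proof. by rewrite cabs_real normr1. Qed.

Lemma cabsD z w : cabs (z + w) <= cabs z + cabs w.
Proof. by rewrite -lecR rmorphD /= -!normC_cabs ler_normD. Qed.

Lemma cabsB z w : cabs (z - w) <= cabs z + cabs w.
Proof. by rewrite -(cabsN w) cabsD. Qed.

Lemma cabs_triangle z w v : cabs (z - w) <= cabs (z - v) + cabs (v - w).
Proof. by apply: le_trans (cabsD _ _); rewrite addrA subrK. Qed.

Lemma cabs_dist z w : `|cabs z - cabs w| <= cabs (z - w).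
Proof.
have h1 := cabsD (z - w) w; have h2 := cabsD (w - z) z.
rewrite !subrK in h1 h2; rewrite cabsBC in h2.
by rewrite ler_norml; apply/andP; split; lra.
Qed.

Lemma cabs_eq0 z : cabs z = 0 -> z = 0.
Proof.
by move=> h; apply/eqP; rewrite -normr_eq0 normC_cabs h.
Qed.

Lemma cabs_gt0 z : z != 0 -> 0 < cabs z.
Proof.
move=> z0; rewrite lt_def cabs_ge0 andbT; apply: contra z0 => /eqP h.
by rewrite (cabs_eq0 h).
Qed.

Lemma cabsX z n : cabs (z ^+ n) = cabs z ^+ n.
Proof. by elim: n => [|n IH]; rewrite ?expr0 ?cabs1 // !exprS cabsM IH. Qed.

Lemma cabsV z : cabs z^-1 = (cabs z)^-1.
Proof.
have [->|z0] := eqVneq z 0; first by rewrite invr0 cabs0 invr0.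
have h : cabs z * cabs z^-1 = 1 by rewrite -cabsM divff // cabs1.
have z1 : cabs z != 0 by rewrite gt_eqF // cabs_gt0.
by apply: (mulfI z1); rewrite h divff.
Qed.

Lemma cabs_conj z : cabs (conjc z) = cabs z.
Proof. by case: z => x y; rewrite /cabs /= sqrrN. Qed.

Lemma Re_cabs z : `|complex.Re z| <= cabs z.
Proof.
by rewrite /cabs -sqrtr_sqr ler_wsqrtr // lerDl sqr_ge0.
Qed.

Lemma Im_cabs z : `|complex.Im z| <= cabs z.
Proof.
by rewrite /cabs -sqrtr_sqr ler_wsqrtr // lerDr sqr_ge0.
Qed.

Lemma ler_Re_cabs z : complex.Re z <= cabs z.
Proof. exact: le_trans (ler_norm _) (Re_cabs z). Qed.

Lemma cabs_ReIm z : cabs z <= `|complex.Re z| + `|complex.Im z|.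
Proof.
rewrite /cabs -[leRHS]ger0_norm ?addr_ge0 // -sqrtr_sqr ler_wsqrtr //.
rewrite sqrrD !real_normK ?num_real // addrAC lerDl.
by rewrite mulrn_wge0 // mulr_ge0.
Qed.

Lemma cabs_sqr z : cabs z ^+ 2 = complex.Re z ^+ 2 + complex.Im z ^+ 2.
Proof. by rewrite /cabs sqr_sqrtr // addr_ge0 // sqr_ge0. Qed.

Lemma cabs_nat n : cabs (n%:R : C) = n%:R.
Proof. by rewrite -(rmorph_nat (real_complex R)) cabs_real normr_nat. Qed.

Lemma cabs_sum (I : Type) (r : seq I) (F : I -> C) :
  cabs (\sum_(i <- r) F i) <= \sum_(i <- r) cabs (F i).
Proof.
elim/big_ind2: _ => [|x y u v h1 h2|//]; first by rewrite cabs0.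
by apply: le_trans (cabsD _ _) _; apply: lerD.
Qed.

Lemma ReD z w : complex.Re (z + w) = complex.Re z + complex.Re w.
Proof. by case: z; case: w. Qed.
Lemma ImD z w : complex.Im (z + w) = complex.Im z + complex.Im w.
Proof. by case: z; case: w. Qed.
Lemma ReM z w : complex.Re (z * w) =
  complex.Re z * complex.Re w - complex.Im z * complex.Im w.
Proof. by case: z; case: w. Qed.
Lemma ImM z w : complex.Im (z * w) =
  complex.Re z * complex.Im w + complex.Im z * complex.Re w.
Proof. by case: z => a b; case: w. Qed.
Lemma ReN z : complex.Re (- z) = - complex.Re z.
Proof. by case: z. Qed.
Lemma ImN z : complex.Im (- z) = - complex.Im z.
Proof. by case: z. Qed.
Lemma Re_conj z : complex.Re (conjc z) = complex.Re z.
Proof. by case: z. Qed.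
Lemma Im_conj z : complex.Im (conjc z) = - complex.Im z.
Proof. by case: z. Qed.
Lemma complex_eqP z w : complex.Re z = complex.Re w ->
  complex.Im z = complex.Im w -> z = w.
Proof. by case: z => a b; case: w => c d /= -> ->. Qed.
Lemma Re_sum (I : Type) (r : seq I) (F : I -> C) :
  complex.Re (\sum_(i <- r) F i) = \sum_(i <- r) complex.Re (F i).
Proof. by elim/big_rec2: _ => // i x y _ <-; rewrite ReD. Qed.
Lemma Im_sum (I : Type) (r : seq I) (F : I -> C) :
  complex.Im (\sum_(i <- r) F i) = \sum_(i <- r) complex.Im (F i).
Proof. by elim/big_rec2: _ => // i x y _ <-; rewrite ImD. Qed.

(** Integrals are taken of real functions only, so estimates of a complex modulus go through the
    real part of a rotated value. *)
Lemma rotate_to_norm z : exists2 c : C, cabs c = 1 & complex.Re (c * z) = cabs z.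
Proof.
have [->|z0] := eqVneq z 0; first by exists 1; rewrite ?cabs1 // mulr0 cabs0.
have nz : cabs z != 0 by rewrite gt_eqF // cabs_gt0.
exists (Complex (cabs z)^-1 0 * conjc z).
  by rewrite cabsM cabs_conj cabs_real normfV ger0_norm ?cabs_ge0 // mulVf.
rewrite -mulrA ReM /= mul0r subr0 ReM Re_conj Im_conj mulNr opprK -!expr2.
by rewrite -cabs_sqr expr2 mulKf.
Qed.
End ComplexModulus.

(** * Complex limits along arbitrary filters *)

Section ComplexLimits.
Variable R : realType.
Local Notation C := R[i].

(** Splitting into real and imaginary parts makes the limit rules of [R] apply directly; [Clim_cabs]
    recovers the modulus form. The filter is left free so that ultrafilters are allowed. *)
Definition Clim (F : set_system nat) (u : nat -> C) (l : C) : Prop :=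
  (fun n => complex.Re (u n)) @ F --> complex.Re l /\
  (fun n => complex.Im (u n)) @ F --> complex.Im l.

Section Filter.
Context (F : set_system nat) {FF : ProperFilter F}.
Implicit Types (u v : nat -> C) (l m : C).

Lemma squeeze0 (f g : nat -> R) : (forall n, 0 <= f n <= g n) ->
  g @ F --> (0 : R) -> f @ F --> (0 : R).
Proof.
move=> h hg; apply: (@squeeze_cvgr _ _ _ _ (fun=> 0) g) => //; last exact: cvg_cst.
by apply: nearW.
Qed.

Lemma Clim_cabs u l :
  Clim F u l <-> (fun n => cabs (u n - l)) @ F --> (0 : R).
Proof.
split=> [[h1 h2]|h].
  have k1 : (fun n => `|complex.Re (u n) - complex.Re l|) @ F --> (0 : R).
    by apply/cvgr0Pnorm_lt => e e0; move/cvgrPdist_lt: h1 => /(_ _ e0);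
       apply: filterS => n /=; rewrite normr_id distrC.
  have k2 : (fun n => `|complex.Im (u n) - complex.Im l|) @ F --> (0 : R).
    by apply/cvgr0Pnorm_lt => e e0; move/cvgrPdist_lt: h2 => /(_ _ e0);
       apply: filterS => n /=; rewrite normr_id distrC.
  have s : (fun n => `|complex.Re (u n) - complex.Re l| +
      `|complex.Im (u n) - complex.Im l|) @ F --> (0 + 0 : R) by exact: cvgD.
  rewrite addr0 in s; apply: (squeeze0 _ s) => n /=; rewrite cabs_ge0 /=.
  by apply: le_trans (cabs_ReIm _) _; rewrite ReD ImD ReN ImN.
split; apply/cvgrPdist_lt => e e0; move/cvgr0_norm_lt: h => /(_ _ e0);
  apply: filterS => n /=; apply: le_lt_trans; rewrite distrC [leRHS]ger0_norm ?cabs_ge0 //.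
  by apply: le_trans (Re_cabs _); rewrite ReD ReN.
by apply: le_trans (Im_cabs _); rewrite ImD ImN.
Qed.

Lemma ClimP u l :
  Clim F u l <-> forall e, 0 < e -> \forall n \near F, cabs (u n - l) < e.
Proof.
rewrite Clim_cabs; split.
  move=> /cvgr0_norm_lt h e /h; apply: filterS => n.
  by rewrite ger0_norm ?cabs_ge0.
move=> h; apply/cvgr0Pnorm_lt => e /h; apply: filterS => n.
by rewrite ger0_norm ?cabs_ge0.
Qed.

Lemma Clim_norm u l : Clim F u l -> (fun n => cabs (u n)) @ F --> cabs l.
Proof.
move=> /ClimP h; apply/cvgrPdist_lt => e /h; apply: filterS => n.
by apply: le_lt_trans; rewrite distrC cabs_dist.
Qed.

Lemma Clim_cst l : Clim F (fun=> l) l.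
Proof. by split; apply: cvg_cst. Qed.

Lemma ClimD u v l m : Clim F u l -> Clim F v m ->
  Clim F (fun n => u n + v n) (l + m).
Proof.
move=> [h1 h2] [k1 k2]; split.
  rewrite ReD (_ : (fun n => _) = (fun n => complex.Re (u n) + complex.Re (v n))).
    exact: cvgD.
  by apply/funext => n; rewrite ReD.
rewrite ImD (_ : (fun n => _) = (fun n => complex.Im (u n) + complex.Im (v n))).
  exact: cvgD.
by apply/funext => n; rewrite ImD.
Qed.

Lemma ClimM u v l m : Clim F u l -> Clim F v m ->
  Clim F (fun n => u n * v n) (l * m).
Proof.
move=> [h1 h2] [k1 k2]; split.
  rewrite ReM (_ : (fun n => _) = (fun n => complex.Re (u n) * complex.Re (v n)
     - complex.Im (u n) * complex.Im (v n))); last by apply/funext => n; rewrite ReM.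
  by apply: cvgB; apply: cvgM.
rewrite ImM (_ : (fun n => _) = (fun n => complex.Re (u n) * complex.Im (v n)
     + complex.Im (u n) * complex.Re (v n))); last by apply/funext => n; rewrite ImM.
by apply: cvgD; apply: cvgM.
Qed.

Lemma ClimB u v l m : Clim F u l -> Clim F v m ->
  Clim F (fun n => u n - v n) (l - m).
Proof.
move=> h k; rewrite -mulN1r (_ : (fun n => _) = (fun n => u n + -1 * v n)).
  by apply: ClimD => //; apply: ClimM => //; apply: Clim_cst.
by apply/funext => n; rewrite mulN1r.
Qed.

Lemma Clim_sum N (u : nat -> nat -> C) (l : nat -> C) :
  (forall k, (k < N)%N -> Clim F (fun n => u n k) (l k)) ->
  Clim F (fun n => \sum_(k < N) u n k) (\sum_(k < N) l k).
Proof.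
elim: N => [|N IH] h.
  rewrite big_ord0 (_ : (fun n => _) = (fun=> 0)); first exact: Clim_cst.
  by apply/funext => n; rewrite big_ord0.
rewrite big_ord_recr (_ : (fun n => _) = (fun n => \sum_(k < N) u n k + u n N)).
  by apply: ClimD; [apply: IH => k kN; apply: h; rewrite ltnS ltnW | apply: h].
by apply/funext => n; rewrite big_ord_recr.
Qed.

Lemma Clim_conj u l : Clim F u l -> Clim F (fun n => conjc (u n)) (conjc l).
Proof.
move=> /ClimP h; apply/ClimP => e /h; apply: filterS => n.
by rewrite -rmorphB cabs_conj.
Qed.

Lemma Clim_unique u l m : Clim F u l -> Clim F u m -> l = m.
Proof.
by move=> [h1 h2] [k1 k2]; apply: complex_eqP;
  [apply: cvg_unique h1 k1 | apply: cvg_unique h2 k2].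
Qed.

Lemma Clim_le u l (M : R) : Clim F u l -> (forall n, cabs (u n) <= M) -> cabs l <= M.
Proof.
move=> /Clim_norm h k; apply: (ler_cvg_to h (cvg_cst M)).
by apply: nearW.
Qed.

(** Exchange of two limits by a three-epsilon argument: the truncation error at [K] is the same for
    all [n], and the finite sum up to [K] converges along [F]. *)
Lemma Clim_uniform_tail (u : nat -> nat -> C) (v : nat -> C) (s : nat -> C) (l : C) :
  (forall k, Clim F (fun n => u n k) (v k)) ->
  (forall e, 0 < e -> exists K, cabs (l - \sum_(k < K) v k) <= e /\
      forall n, cabs (s n - \sum_(k < K) u n k) <= e) ->
  Clim F s l.
Proof.
move=> h t; apply/ClimP => e e0.
have e4 : 0 < e / 4 by rewrite divr_gt0.
have [K [t1 t2]] := t _ e4.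
have /ClimP/(_ _ e4) := @Clim_sum K u v (fun k _ => h k).
apply: filterS => n hn.
have a1 := cabs_triangle (s n) l (\sum_(k < K) u n k).
have a2 := cabs_triangle (\sum_(k < K) u n k) l (\sum_(k < K) v k).
have := t2 n; rewrite (cabsBC l) in t1 => t2n; lra.
Qed.
End Filter.

Lemma Clim_subfilter (F G : set_system nat) u l : G `<=` F ->
  Clim G u l -> Clim F u l.
Proof. by move=> GF [h1 h2]; split=> A; [move/h1|move/h2]; apply: GF. Qed.

Lemma CcvgE u (l : C) : Ccvg u l <-> Clim \oo u l.
Proof. by rewrite Clim_cabs. Qed.

Lemma Clim_bounded u (l : C) : Clim \oo u l -> exists K, forall n, cabs (u n) <= K.
Proof.
move=> /Clim_norm h.
have /cvg_seq_bounded [K [_ /(_ (K+1))]] :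
    cvgn (fun n => cabs (u n)) by apply/cvg_ex; exists (cabs l).
rewrite ltrDl => /(_ ltr01) b; exists (K + 1) => n.
by have := b n I; rewrite /= ger0_norm ?cabs_ge0.
Qed.

Section Ultra.
Context (U : set_system nat) {UU : UltraFilter U}.

Lemma ultra_cvg (u : nat -> R) (M : R) : (forall n, `|u n| <= M) ->
  exists l : R, u @ U --> l.
Proof.
move=> h; have := @segment_compact R (- M) M.
move=> /(_ (u @ U) _) [].
  rewrite /=; apply: filterE => n /=.
  by rewrite in_itv /= -ler_norml.
move=> l [_ hl]; exists l => V hV.
(* The ultrafilter contains the preimage of [V] or that of its complement; the latter would
   contradict that [l] is a cluster point. *)
have [//|hc] := in_ultra_setVsetC (u @^-1` V) UU.
by have [x []] := hl (~` V) V hc hV.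
Qed.

Lemma ultra_Clim (u : nat -> C) (M : R) : (forall n, cabs (u n) <= M) ->
  exists l : C, Clim U u l.
Proof.
move=> h.
have [a ha] := @ultra_cvg (fun n => complex.Re (u n)) M
  (fun n => le_trans (Re_cabs _) (h n)).
have [b Hinf_le] := @ultra_cvg (fun n => complex.Im (u n)) M
  (fun n => le_trans (Im_cabs _) (h n)).
by exists (Complex a b).
Qed.
End Ultra.
End ComplexLimits.
Arguments Clim_cst {R} F {FF} l.

(** * Absolutely convergent complex series *)

Section Series.
Variable R : realType.
Local Notation C := R[i].
Implicit Types (u v f g x y : nat -> C) (w : nat -> R).

Definition csum u : C :=
  Complex (limn (fun n => complex.Re (\sum_(k < n) u k)))
          (limn (fun n => complex.Im (\sum_(k < n) u k))).

Definition cconv u (l : C) := Clim \oo (fun n => \sum_(k < n) u k) l.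

Lemma csum_unique u l : cconv u l -> csum u = l.
Proof.
by move=> [h1 h2]; apply: complex_eqP; apply/cvg_lim.
Qed.

Definition dominated u w := (forall k, cabs (u k) <= w k) /\ cvgn (series w).

Definition tail w n : R := limn (series w) - series w n.

Lemma tail_cvg0 w : cvgn (series w) -> tail w @ \oo --> 0.
Proof.
move=> h; rewrite -(subrr (limn (series w))); apply: cvgB => //.
exact: cvg_cst.
Qed.

Lemma tail_small w e : cvgn (series w) -> 0 < e -> exists K, tail w K < e.
Proof.
move=> /tail_cvg0/cvgr0_norm_lt h /h [K _ /(_ K (leqnn K))].
by move=> /= /(le_lt_trans (ler_norm _)) h'; exists K.
Qed.

Lemma series_ge0_tail w n m : (forall k, 0 <= w k) -> cvgn (series w) ->
  (n <= m)%N -> series w m - series w n <= tail w n.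
Proof.
move=> w0 h nm; rewrite lerB // ; apply: nondecreasing_cvgn_le => //.
by apply: nondecreasing_series.
Qed.

Lemma dominated_cvg u w : dominated u w -> cconv u (csum u).
Proof.
move=> [h1 h2].
have hh (p : nat -> R) : (forall k, `|p k| <= w k) ->
    cvgn (fun n => \sum_(k < n) p k).
  move=> hp; rewrite (_ : (fun n => _) = series p); last first.
    by apply/funext => n; rewrite /series /= big_mkord.
  apply: normed_cvg; apply: series_le_cvg h2 => //= k.
  exact: le_trans (hp k).
split.
  have := @hh (fun k => complex.Re (u k)) (fun k => le_trans (Re_cabs _) (h1 k)).
  rewrite /csum /= (_ : (fun n => complex.Re _) =
    (fun n => \sum_(k < n) complex.Re (u k))) //.
  by apply/funext => n; rewrite Re_sum.
have := @hh (fun k => complex.Im (u k)) (fun k => le_trans (Im_cabs _) (h1 k)).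
rewrite /csum /= (_ : (fun n => complex.Im _) =
  (fun n => \sum_(k < n) complex.Im (u k))) //.
by apply/funext => n; rewrite Im_sum.
Qed.

Lemma dominated_ge0 u w k : dominated u w -> 0 <= w k.
Proof. by move=> [h _]; apply: le_trans (cabs_ge0 _) (h k). Qed.

Lemma cabs_sum_tail u w n m : dominated u w -> (n <= m)%N ->
  cabs (\sum_(k < m) u k - \sum_(k < n) u k) <= tail w n.
Proof.
move=> d nm.
apply: le_trans (series_ge0_tail (fun k => dominated_ge0 k d) (d.2) nm).
rewrite -!(big_mkord xpredT) /series /= !(big_cat_nat (leq0n n) nm) /=.
rewrite [X in cabs (X - _)]addrC addrK [X in _ <= X - _]addrC addrK.
by apply: le_trans (cabs_sum _ _) _; apply: ler_sum => i _; apply: d.1.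
Qed.

Lemma csum_tail u w n : dominated u w -> cabs (csum u - \sum_(k < n) u k) <= tail w n.
Proof.
move=> d; pose proof (Clim_norm (ClimB (dominated_cvg d) (Clim_cst \oo (\sum_(k < n) u k)))) as h'.
 apply: (ler_cvg_to h' (cvg_cst (tail w n))).
by exists n => // m nm /=; apply: cabs_sum_tail.
Qed.

Lemma cabs_csum u w : dominated u w -> cabs (csum u) <= limn (series w).
Proof.
by move=> d; have := csum_tail 0 d; rewrite big_ord0 subr0 /tail /series /= big_geq // subr0.
Qed.

Lemma cconvD u v l m : cconv u l -> cconv v m -> cconv (fun k => u k + v k) (l + m).
Proof.
move=> h k; pose proof (ClimD h k) as hk.
by rewrite /cconv; under eq_fun do rewrite big_split.
Qed.

Lemma cconvZ c u l : cconv u l -> cconv (fun k => c * u k) (c * l).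
Proof.
move=> h; pose proof (ClimM (Clim_cst \oo c) h) as hk.
by rewrite /cconv; under eq_fun do rewrite -mulr_sumr.
Qed.

Lemma cconv_conj u l : cconv u l -> cconv (fun k => conjc (u k)) (conjc l).
Proof.
move=> h; pose proof (Clim_conj h) as hk.
by rewrite /cconv; under eq_fun do rewrite -rmorph_sum.
Qed.

Lemma cconv0 : cconv (fun=> 0) 0.
Proof. by rewrite /cconv; under eq_fun do rewrite big1 //; apply: Clim_cst. Qed.

Lemma tannery (F : set_system nat) (FF : ProperFilter F)
    (u : nat -> nat -> C) v w :
  (forall n, dominated (u n) w) -> (forall k, Clim F (u^~ k) (v k)) ->
  dominated v w /\ Clim F (fun n => csum (u n)) (csum v).
Proof.
move=> d h.
have dv : dominated v w.
  split=> [k|]; last exact: (d 0%N).2.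
  by apply: (Clim_le (h k)) => n; apply: (d n).1.
split=> //; apply: (Clim_uniform_tail h) => e e0.
have [K hK] := tail_small (dv.2) e0; exists K; split=> [|n].
  by apply: le_trans (csum_tail K dv) (ltW hK).
by apply: le_trans (csum_tail K (d n)) (ltW hK).
Qed.

Lemma triangle_sum (F : nat -> nat -> C) N :
  \sum_(n < N) \sum_(k < n.+1) F k (n - k)%N = \sum_(k < N) \sum_(j < N - k) F k j.
Proof.
elim: N => [|N IH]; first by rewrite !big_ord0.
rewrite big_ord_recr /= IH [RHS]big_ord_recr /= subSnn big_ord1.
rewrite [X in _ + X]big_ord_recr /= subnn addrA; congr (_ + _).
rewrite -big_split /=; apply: eq_bigr => k _.
by rewrite subSn ?(ltnW (ltn_ord k)) // big_ord_recr.
Qed.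

(** The partial sums of the Cauchy product are sums over [k < n] of [u k] times the partial sum
    [V (n - k)] of [v]. These are bounded and tend to [l] for each fixed [k], so [tannery] applies;
    [v] need not converge absolutely. *)
Lemma mertens u v w l : dominated u w -> cconv v l ->
  cconv (fun n => \sum_(k < n.+1) u k * v (n - k)%N) (csum u * l).
Proof.
move=> d hv; rewrite /cconv.
pose V n := \sum_(j < n) v j.
have [B hB] := Clim_bounded hv.
have {}hB n : cabs (V n) <= B by apply: hB.
have B0 : 0 <= B := le_trans (cabs_ge0 _) (hB 0%N).
pose t n k := if (k < n)%N then u k * V (n - k)%N else 0.
have d2 n : dominated (t n) (fun k => B * w k).
  split=> [k|].
    rewrite /t; case: ifP => _.
      rewrite cabsM mulrC; apply: ler_pM; rewrite ?cabs_ge0 //; exact: d.1.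
    by rewrite cabs0 mulr_ge0 // (dominated_ge0 k d).
  have -> : series (fun k => B * w k) = B *: series w.
    by apply/funext => m; rewrite /series /= -mulr_sumr.
  by apply: is_cvgZr; apply: d.2.
have ht k : Clim \oo (t^~ k) (u k * l).
  apply/ClimP => e e0.
  pose proof (ClimM (Clim_cst \oo (u k)) hv) as hk.
  move/ClimP : hk => /(_ _ e0) [M _ hM]; exists (M + k.+1)%N => // n /= hn.
  rewrite /t ifT; last by apply: leq_trans hn; rewrite leq_addl.
  by apply: hM => /=; rewrite leq_subRL; [apply: leq_trans hn; rewrite addnC leq_add2l|
     apply: leq_trans hn; rewrite ltnW // leq_addl].
have [_] := tannery _ d2 ht.
have -> : csum (fun k => u k * l) = csum u * l.
  apply: csum_unique; rewrite mulrC.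
  by have := cconvZ l (dominated_cvg d); under eq_fun do rewrite mulrC.
suff -> : (fun n => csum (t n)) =
  (fun n => \sum_(m < n) \sum_(k < m.+1) u k * v (m - k)%N) by [].
apply/funext => n; rewrite (triangle_sum (fun a b => u a * v b)); apply: csum_unique.
apply/ClimP => e e0; exists n => // m /= nm.
rewrite -(subnKC nm) big_split_ord /= [X in _ + X - _]big1 ?addr0; last first.
  by move=> i _; rewrite /t ltnNge leq_addr.
under eq_bigr => k _ do rewrite /t ltn_ord /V mulr_sumr.
by rewrite subrr cabs0.
Qed.
End Series.

(** * Power series in the unit disc *)

Section PowerSeries.
Variable R : realType.
Local Notation C := R[i].
Implicit Types (a f g h : nat -> C) (z : C) (r s : R).

(** Radius of convergence at least 1, in the form used by Abel's lemma. *)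
Definition bdisc f := forall r, 0 <= r < 1 ->
  exists K, forall k, cabs (f k) * r ^+ k <= K.

Definition ev f z : C := csum (fun k => f k * z ^+ k).

Lemma summable_disc f r : bdisc f -> 0 <= r < 1 ->
  cvgn (series (fun k => cabs (f k) * r ^+ k)).
Proof.
move=> hf /andP[r0 r1]; pose q := (1 + r) / 2.
have q1 : 0 <= q < 1 by rewrite /q; apply/andP; split; lra.
have q0 : 0 < q by rewrite /q; lra.
have [K hK] := hf q q1.
have hg : cvgn (series (geometric K (r / q))).
  apply: is_cvg_geometric_series.
  by rewrite ger0_norm ?(divr_ge0 r0 (ltW q0)) // ltr_pdivrMr // mul1r /q; lra.
apply: series_le_cvg hg => k.
- by rewrite mulr_ge0 ?cabs_ge0 ?exprn_ge0.
- have K0 : 0 <= K.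
    by apply: le_trans (hK 0%N); rewrite mulr_ge0 ?cabs_ge0 ?exprn_ge0 // ltW.
  by rewrite /geometric /= mulr_ge0 // exprn_ge0 // divr_ge0 // ltW.
have -> : cabs (f k) * r ^+ k = cabs (f k) * q ^+ k * (r / q) ^+ k.
  by rewrite -mulrA -exprMn mulrCA divff ?mulr1 // lt0r_neq0.
by rewrite /geometric /= ler_wpM2r // exprn_ge0 // divr_ge0 // ltW.
Qed.

Lemma bdisc_dominated f z r : bdisc f -> cabs z <= r -> r < 1 ->
  dominated (fun k => f k * z ^+ k) (fun k => cabs (f k) * r ^+ k).
Proof.
move=> hf zr r1; split=> [k|]; last first.
  by apply: summable_disc => //; rewrite r1 (le_trans (cabs_ge0 z)).
by rewrite cabsM cabsX ler_wpM2l ?cabs_ge0 // lerXn2r ?nnegrE ?cabs_ge0 //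
  (le_trans (cabs_ge0 z)).
Qed.

Lemma ev_cvg f z : bdisc f -> cabs z < 1 -> cconv (fun k => f k * z ^+ k) (ev f z).
Proof. by move=> hf z1; apply: dominated_cvg (bdisc_dominated hf (lexx _) z1). Qed.

Lemma ev_unique f z l : cconv (fun k => f k * z ^+ k) l -> ev f z = l.
Proof. exact: csum_unique. Qed.

Lemma bdisc_cconv f :
  (forall r, 0 <= r < 1 -> exists l, cconv (fun k => f k * (Complex r 0) ^+ k) l) ->
  bdisc f.
Proof.
move=> h r r01; have [l hl] := h r r01.
have [B hB] := Clim_bounded hl; exists (B + B) => k.
have /andP[r0 _] := r01.
rewrite -[r in X in X <= _]ger0_norm // -cabs_real -cabsX -cabsM.
have := hB k.+1; rewrite big_ord_recr /= => h1; have h2 := hB k.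
have := cabsB (\sum_(i < k) f i * (Complex r 0) ^+ i + f k * (Complex r 0) ^+ k)
  (\sum_(i < k) f i * (Complex r 0) ^+ i).
rewrite addrAC subrr add0r; lra.
Qed.

Lemma cabs_realc r : 0 <= r -> cabs (Complex r 0) = r.
Proof. by move=> r0; rewrite cabs_real ger0_norm. Qed.

(** The pattern for all operations on series below: one proof of pointwise convergence yields both
    the radius of convergence and the value. *)
Lemma bdisc_ev f (E : R[i] -> R[i]) :
  (forall z, cabs z < 1 -> cconv (fun k => f k * z ^+ k) (E z)) ->
  bdisc f /\ forall z, cabs z < 1 -> ev f z = E z.
Proof.
move=> h; split=> [|z /h/ev_unique //].
apply: bdisc_cconv => r /andP[r0 r1]; exists (E (Complex r 0)).
by apply: h; rewrite cabs_realc.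
Qed.

Lemma ev_add f g : bdisc f -> bdisc g ->
  bdisc (fun k => f k + g k) /\
  forall z, cabs z < 1 -> ev (fun k => f k + g k) z = ev f z + ev g z.
Proof.
move=> hf hg; apply: (bdisc_ev (E := fun z => ev f z + ev g z)) => z z1.
have := cconvD (ev_cvg hf z1) (ev_cvg hg z1).
by under eq_fun do rewrite -mulrDl.
Qed.

Lemma ev_scale c f : bdisc f ->
  bdisc (fun k => c * f k) /\
  forall z, cabs z < 1 -> ev (fun k => c * f k) z = c * ev f z.
Proof.
move=> hf; apply: (bdisc_ev (E := fun z => c * ev f z)) => z z1.
have := cconvZ c (ev_cvg hf z1).
by under eq_fun do rewrite mulrA.
Qed.

Lemma ev_sub f g : bdisc f -> bdisc g ->
  bdisc (fun k => f k - g k) /\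
  forall z, cabs z < 1 -> ev (fun k => f k - g k) z = ev f z - ev g z.
Proof.
move=> hf hg; have [b e] := ev_scale (-1) hg; have [b' e'] := ev_add hf b.
have E : (fun k => f k - g k) = (fun k => f k + -1 * g k).
  by apply/funext => k; rewrite mulN1r.
by rewrite E; split=> // z z1; rewrite e' // e // mulN1r.
Qed.

Lemma ev_sum N (c : nat -> C) (f : nat -> nat -> C) : (forall i, bdisc (f i)) ->
  bdisc (fun k => \sum_(i < N) c i * f i k) /\
  forall z, cabs z < 1 ->
    ev (fun k => \sum_(i < N) c i * f i k) z = \sum_(i < N) c i * ev (f i) z.
Proof.
move=> hf; apply: (bdisc_ev (E := fun z => \sum_(i < N) c i * ev (f i) z)) => z z1.
elim: N => [|N IH].
  rewrite big_ord0; under eq_fun do rewrite big_ord0 mul0r; exact: cconv0.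
rewrite big_ord_recr; under eq_fun do rewrite big_ord_recr mulrDl.
apply: cconvD => //=; have [b e] := ev_scale (c N) (hf N).
by rewrite -e //; apply: ev_cvg.
Qed.

Lemma ev_Toep a f : bdisc a -> bdisc f ->
  bdisc (Toep a f) /\
  forall z, cabs z < 1 -> ev (Toep a f) z = ev a z * ev f z.
Proof.
move=> ha hf; apply: (bdisc_ev (E := fun z => ev a z * ev f z)) => z z1.
have := mertens (bdisc_dominated ha (lexx _) z1) (ev_cvg hf z1).
suff -> : (fun n => \sum_(k < n.+1) a k * z ^+ k * (f (n - k)%N * z ^+ (n - k))) =
  (fun k => Toep a f k * z ^+ k) by [].
apply/funext => n; rewrite /Toep mulr_suml; apply: eq_bigr => k _.
by rewrite mulrACA -exprD subnKC // -ltnS ltn_ord.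
Qed.

Lemma ev_iter_Toep a f m : bdisc a -> bdisc f ->
  bdisc (iter m (Toep a) f) /\
  forall z, cabs z < 1 -> ev (iter m (Toep a) f) z = ev a z ^+ m * ev f z.
Proof.
move=> ha hf; elim: m => [|m [IH1 IH2]]; first by split=> // z _; rewrite mul1r.
have [b e] := ev_Toep ha IH1; split=> // z z1.
by rewrite iterS e // IH2 // exprS mulrA.
Qed.

Definition mono j : nat -> C := fun k => (k == j)%:R.

Lemma ev_mono j : bdisc (mono j) /\ forall z, cabs z < 1 -> ev (mono j) z = z ^+ j.
Proof.
apply: (bdisc_ev (E := fun z => z ^+ j)) => z z1.
apply/ClimP => e e0; exists j.+1 => // n /= jn.
rewrite (bigD1 (Ordinal jn)) //= /mono eqxx mul1r big1 ?addr0 ?subrr ?cabs0 //.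
by move=> i; rewrite -val_eqE /= => /negbTE ->; rewrite mul0r.
Qed.

Definition dilate s f : nat -> C := fun k => f k * (Complex s 0) ^+ k.

Lemma cabs_dilate s z : 0 <= s <= 1 -> cabs (Complex s 0 * z) <= cabs z.
Proof.
move=> /andP[s0 s1]; rewrite cabsM cabs_realc //.
by rewrite ler_piMl // cabs_ge0.
Qed.

Lemma ev_dilate s f : 0 <= s <= 1 -> bdisc f ->
  bdisc (dilate s f) /\
  forall z, cabs z < 1 -> ev (dilate s f) z = ev f (Complex s 0 * z).
Proof.
move=> s01 hf; apply: bdisc_ev => z z1.
have := ev_cvg hf (le_lt_trans (cabs_dilate z s01) z1).
by under eq_fun do rewrite exprMn mulrA.
Qed.

Lemma ev_bounded f r : bdisc f -> 0 <= r < 1 ->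
  exists2 W, 0 <= W & forall z, cabs z <= r -> cabs (ev f z) <= W.
Proof.
move=> hf /andP[r0 r1]; exists (limn (series (fun k => cabs (f k) * r ^+ k))).
  apply: le_trans (cabs_ge0 (ev f 0)) _; apply: (cabs_csum (bdisc_dominated _ _ _)) => //.
  by rewrite cabs0.
by move=> z zr; apply: (cabs_csum (bdisc_dominated hf zr r1)).
Qed.

Lemma ev_dilate_cvg (F : set_system nat) (FF : ProperFilter F) (s : nat -> R) f z l :
  bdisc f -> cabs z < 1 -> (forall n, 0 <= s n <= 1) -> s @ F --> l ->
  Clim F (fun n => ev f (Complex (s n) 0 * z)) (ev f (Complex l 0 * z)).
Proof.
move=> hf z1 hs sl.
have sc : Clim F (fun n => Complex (s n) 0) (Complex l 0) by split=> //=; apply: cvg_cst.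
have h n : dominated (fun k => f k * (Complex (s n) 0 * z) ^+ k)
    (fun k => cabs (f k) * cabs z ^+ k).
  by apply: bdisc_dominated => //; apply: cabs_dilate.
apply: (tannery _ h _).2 => k.
apply: ClimM; first exact: Clim_cst.
elim: k => [|k IH]; first exact: Clim_cst.
under eq_fun do rewrite exprS; rewrite exprS.
by apply: ClimM => //; apply: ClimM => //; apply: Clim_cst.
Qed.
End PowerSeries.

(** * Circle means and the Poisson kernel *)

Section Expi.
Variable R : realType.
Local Notation C := R[i].
Implicit Types (s t : R).

Lemma expiD s t : expi (s + t) = expi s * expi t :> C.
Proof. by apply: complex_eqP; rewrite ?ReM ?ImM /= ?cosD ?sinD // addrC. Qed.

Lemma expi0 : expi 0 = 1 :> C.
Proof. by rewrite /expi cos0 sin0. Qed.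

Lemma expi2pi : expi (2 * pi) = 1 :> C.
Proof. by rewrite /expi mulr_natl cos2pi sin2pi. Qed.

Lemma expiN t : expi (- t) = conjc (expi t) :> C.
Proof. by rewrite /expi cosN sinN. Qed.

Lemma expiX t n : expi (n%:R * t) = expi t ^+ n :> C.
Proof.
elim: n => [|n IH]; first by rewrite mul0r expi0.
by rewrite -addn1 natrD mulrDl mul1r expiD IH addn1 exprSr.
Qed.

Lemma cabs_expi t : cabs (expi t) = 1.
Proof. by rewrite /cabs /= cos2Dsin2 sqrtr1. Qed.

Lemma expi_freq t k l :
  expi t ^+ k * conjc (expi t ^+ l) = expi ((k%:R - l%:R) * t).
Proof. by rewrite -!expiX -expiN -expiD; congr expi; ring. Qed.
End Expi.

Lemma continuous_sum (R : realType) N (f : nat -> R -> R) :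
  (forall i, continuous (f i)) -> continuous (fun t => \sum_(i < N) f i t).
Proof.
move=> cf; elim: N => [|N IH].
  have -> : (fun t => \sum_(i < 0) f i t) = fun=> 0.
    by apply/funext => t; rewrite big_ord0.
  by move=> t; apply: cvg_cst.
have -> : (fun t => \sum_(i < N.+1) f i t) = (fun t => \sum_(i < N) f i t + f N t).
  by apply/funext => t; rewrite big_ord_recr.
by move=> t; apply: cvgD; [apply: IH | apply: cf].
Qed.

(** * Normalized integrals over the circle and orthogonality of the exponentials *)

Section CircleMean.
Variable R : realType.
Local Notation C := R[i].
Local Notation mu := (@lebesgue_measure R).
Local Notation I2pi := (`[0, 2 * pi]%classic : set R).
Implicit Types (f g : R -> R).

Definition L1 f : Prop := mu.-integrable `[0, 2 * pi] (EFin \o f).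

Definition mean f : R := (2 * pi)^-1 * Rintegral mu `[0, 2 * pi] f.

Lemma twopi_gt0 : 0 < 2 * pi :> R.
Proof. by rewrite mulr_gt0 // pi_gt0. Qed.

Lemma L1_cont f : continuous f -> L1 f.
Proof.
move=> cf; apply: continuous_compact_integrable; first exact: segment_compact.
exact: continuous_subspaceT.
Qed.

Lemma L1D f g : L1 f -> L1 g -> L1 (fun t => f t + g t).
Proof. by move=> hf hg; exact: (@integrableD _ _ _ mu _ _ _ _ hf hg). Qed.

Lemma L1Z c f : L1 f -> L1 (fun t => c * f t).
Proof. by move=> hf; exact: (@integrableZl _ _ _ mu _ _ c _ hf). Qed.

Lemma L1_norm f : L1 f -> L1 (fun t => `|f t|).
Proof. by move=> hf; apply: (integrable_norm hf). Qed.

Lemma L1_mulc f g : continuous f -> L1 g -> L1 (fun t => f t * g t).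
Proof.
move=> cf hg; apply: (@integrableMr _ _ _ mu I2pi _ f (EFin \o g)) => //.
  by apply: measurable_funTS; apply: continuous_measurable_fun.
have /compact_bounded := continuous_compact
  (continuous_subspaceT (A := I2pi) cf) (@segment_compact R 0 (2 * pi)).
by move=> [M [Mr hM]]; exists M; split=> // x Mx y hy /=; apply: hM => //; exists y.
Qed.

Lemma L1_le f g : measurable_fun I2pi f -> L1 g ->
  (forall t, `|f t| <= g t) -> L1 f.
Proof.
move=> mf hg h; apply: (le_integrable _ _ _ hg) => //.
  exact/measurable_EFinP.
by move=> t _ /=; rewrite lee_fin (le_trans (h t)) // ler_norm.
Qed.

Lemma meanD f g : L1 f -> L1 g -> mean (fun t => f t + g t) = mean f + mean g.
Proof. by move=> hf hg; rewrite /mean RintegralD // mulrDr. Qed.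

Lemma meanZ c f : L1 f -> mean (fun t => c * f t) = c * mean f.
Proof. by move=> hf; rewrite /mean RintegralZl // mulrCA. Qed.

Lemma mean_le f g : L1 f -> L1 g -> (forall t, f t <= g t) -> mean f <= mean g.
Proof.
move=> hf hg h; rewrite /mean ler_wpM2l ?invr_ge0 ?(ltW twopi_gt0) //.
exact: le_Rintegral.
Qed.

Lemma mean_cst c : mean (fun=> c) = c.
Proof.
rewrite /mean Rintegral_cst //= lebesgue_measure_itv /= lte_fin twopi_gt0.
by rewrite oppr0 adde0 /= mulrCA mulVf ?mulr1 // lt0r_neq0 // twopi_gt0.
Qed.

Lemma mean_ge0 f : (forall t, 0 <= f t) -> 0 <= mean f.
Proof.
move=> h; rewrite mulr_ge0 ?invr_ge0 ?(ltW twopi_gt0) //.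
exact: Rintegral_ge0.
Qed.

Lemma mean_norm f : L1 f -> `|mean f| <= mean (fun t => `|f t|).
Proof.
move=> hf; rewrite /mean normrM ger0_norm ?invr_ge0 ?(ltW twopi_gt0) //.
by rewrite ler_wpM2l ?invr_ge0 ?(ltW twopi_gt0) // le_normr_Rintegral.
Qed.

Lemma mean_sum N (f : nat -> R -> R) : (forall i, L1 (f i)) ->
  L1 (fun t => \sum_(i < N) f i t) /\
  mean (fun t => \sum_(i < N) f i t) = \sum_(i < N) mean (f i).
Proof.
move=> hf; elim: N => [|N [IH1 IH2]].
  rewrite big_ord0; under eq_fun do rewrite big_ord0.
  by split; [apply: L1_cont => t; apply: cvg_cst | exact: mean_cst].
rewrite big_ord_recr; under eq_fun do rewrite big_ord_recr.
by split; [apply: L1D | rewrite meanD // IH2].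
Qed.

(** The hypothesis on [expi] says that the frequency [m] is an integer of either sign; it makes the
    antiderivative [F] take the same value at both ends. *)
Lemma mean_trig (a b m : R) : m != 0 -> expi (m * (2 * pi)) = 1 :> C ->
  mean (fun t => a * cos (m * t) - b * sin (m * t)) = 0.
Proof.
move=> m0 hm.
pose F t := m^-1 * (a * sin (m * t) + b * cos (m * t)).
have dF t : is_derive t (1:R) F (a * cos (m * t) - b * sin (m * t)).
  rewrite /F; apply: is_derive_eq.
  by rewrite /GRing.scale /=; field.
have cF : continuous F.
  move=> t; apply: differentiable_continuous; apply/derivable1_diffP.
  by have [] := dF t.
have cf : continuous (fun t : R => a * cos (m * t) - b * sin (m * t)).
  have cm : continuous (fun t : R => m * t).
    by move=> t; apply: cvgM; [apply: cvg_cst | apply: cvg_id].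
  move=> t; apply: cvgB; apply: cvgM; try exact: cvg_cst.
    by apply: continuous_comp; [apply: cm | apply: continuous_cos].
  by apply: continuous_comp; [apply: cm | apply: continuous_sin].
rewrite /mean /Rintegral (@continuous_FTC2 _ _ F _ _ twopi_gt0); first last.
- by move=> t _; rewrite derive1E; apply: (@derive_val _ _ _ _ _ _ _ (dF t)).
- split.
  + by move=> t _; have [] := dF t.
  + by apply: cvg_at_right_filter; apply: cF.
  + by apply: cvg_at_left_filter; apply: cF.
- exact: continuous_subspaceT.
have -> : F (2 * pi) = F 0.
  by rewrite /F mulr0 cos0 sin0; move: hm => [-> ->].
by rewrite -EFinB subrr /= mulr0.
Qed.

Lemma continuous_trig (c : C) (m : R) :
  continuous (fun t : R => complex.Re (c * expi (m * t))).
Proof.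
have cm : continuous (fun t : R => m * t).
  by move=> t; apply: cvgM; [apply: cvg_cst | apply: cvg_id].
under eq_fun do rewrite ReM /=.
move=> t; apply: cvgB; apply: cvgM; try exact: cvg_cst.
  by apply: continuous_comp; [apply: cm | apply: continuous_cos].
by apply: continuous_comp; [apply: cm | apply: continuous_sin].
Qed.

Lemma expi_int_2pi k l : expi ((k%:R - l%:R) * (2 * pi)) = 1 :> C.
Proof. by rewrite -expi_freq expi2pi !expr1n conjc1 mulr1. Qed.

Lemma mean_freq (c : C) k l :
  L1 (fun t => complex.Re (c * (expi t ^+ k * conjc (expi t ^+ l)))) /\
  mean (fun t => complex.Re (c * (expi t ^+ k * conjc (expi t ^+ l)))) =
    (k == l)%:R * complex.Re c.
Proof.
under eq_fun do rewrite expi_freq.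
split; first by apply: L1_cont; apply: continuous_trig.
have [->|kl] := eqVneq k l.
  under eq_fun do rewrite subrr mul0r expi0 mulr1.
  by rewrite mean_cst mul1r.
under eq_fun do rewrite ReM /=.
rewrite mul0r mean_trig //; last exact: expi_int_2pi.
by rewrite subr_eq0 eqr_nat.
Qed.

Lemma parseval N (s : nat -> C) :
  L1 (fun t => cabs (\sum_(k < N) s k * expi t ^+ k) ^+ 2) /\
  mean (fun t => cabs (\sum_(k < N) s k * expi t ^+ k) ^+ 2) =
    \sum_(k < N) cabs (s k) ^+ 2.
Proof.
have Ez (z : C) : cabs z ^+ 2 = complex.Re (z * conjc z).
  by rewrite cabs_sqr ReM Re_conj Im_conj mulrN opprK.
have E t : cabs (\sum_(k < N) s k * expi t ^+ k) ^+ 2 =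
    \sum_(k < N) \sum_(l < N)
      complex.Re (s k * conjc (s l) * (expi t ^+ k * conjc (expi t ^+ l))).
  rewrite Ez rmorph_sum mulr_suml Re_sum; apply: eq_bigr => k _.
  rewrite mulr_sumr Re_sum; apply: eq_bigr => l _.
  by rewrite rmorphM /= mulrACA.
under eq_fun do rewrite E.
have h k := mean_sum N (fun l => (mean_freq (s k * conjc (s l)) k l).1).
have [h1 ->] := mean_sum N (fun k => (h k).1); split=> //.
apply: eq_bigr => k _; rewrite (h k).2 (bigD1 k) //= big1 ?addr0.
  by rewrite (mean_freq _ _ _).2 eqxx mul1r Ez.
by move=> l lk; rewrite (mean_freq _ _ _).2 eq_sym val_eqE (negbTE lk) mul0r.
Qed.
End CircleMean.

(** * The Poisson kernel and subharmonicity of polynomials *)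

Section PoissonKernel.
Variable R : realType.
Local Notation C := R[i].
Implicit Types (z w : C) (t : R) (f : R -> R).

Definition poisson_arg z t : C := z * conjc (expi t).

Definition poisson z t : R :=
  (1 - cabs z ^+ 2) / cabs (1 - poisson_arg z t) ^+ 2.

(** A partial sum of the Fourier expansion of the Poisson kernel. Being a trigonometric polynomial,
    it reduces means to orthogonality relations. *)
Definition poisson_trunc z N t : R :=
  complex.Re (1 + 2 * \sum_(j < N) poisson_arg z t ^+ j.+1).

Lemma cabs_poisson_arg z t : cabs (poisson_arg z t) = cabs z.
Proof. by rewrite cabsM cabs_conj cabs_expi mulr1. Qed.

Lemma poisson_den_gt0 z t : cabs z < 1 -> 0 < cabs (1 - poisson_arg z t).
Proof.
move=> z1; apply: cabs_gt0; rewrite subr_eq0; apply/eqP => h.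
by move: z1; rewrite -(cabs_poisson_arg z t) -h cabs1 ltxx.
Qed.

Lemma poisson_ge0 z t : cabs z < 1 -> 0 <= poisson z t.
Proof.
move=> z1; rewrite divr_ge0 ?sqr_ge0 // subr_ge0 expr_le1 ?cabs_ge0 //.
exact: ltW.
Qed.

Lemma poisson_denE z t : cabs (1 - poisson_arg z t) ^+ 2 =
  (1 - (complex.Re z * cos t + complex.Im z * sin t)) ^+ 2 +
  (complex.Im z * cos t - complex.Re z * sin t) ^+ 2.
Proof. by rewrite cabs_sqr; case: z => x y /=; ring. Qed.

Lemma continuous_poisson z : cabs z < 1 -> continuous (poisson z).
Proof.
move=> z1.
have E : poisson z = fun t => (1 - cabs z ^+ 2) *
    ((1 - (complex.Re z * cos t + complex.Im z * sin t)) ^+ 2 +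
     (complex.Im z * cos t - complex.Re z * sin t) ^+ 2)^-1.
  by apply/funext => t; rewrite /poisson poisson_denE.
have hne t : (1 - (complex.Re z * cos t + complex.Im z * sin t)) ^+ 2 +
     (complex.Im z * cos t - complex.Re z * sin t) ^+ 2 != 0.
  by rewrite -poisson_denE lt0r_neq0 // exprn_gt0 // poisson_den_gt0.
rewrite E => t; apply: cvgM; first exact: cvg_cst.
apply: cvgV; first exact: hne.
have cc : {for t, continuous (@cos R)} by apply: continuous_cos.
have cs : {for t, continuous (@sin R)} by apply: continuous_sin.
apply: cvgD; rewrite expr2; under eq_fun do rewrite expr2; apply: cvgM.
all: try (apply: cvgB; first exact: cvg_cst; apply: cvgD; apply: cvgM => //; exact: cvg_cst).
all: by apply: cvgB; apply: cvgM => //; exact: cvg_cst.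
Qed.

(** With [w = poisson_arg z t] the kernel is the real part of [(1 + w) / (1 - w)], and summing the
    geometric progression leaves the remainder [2 w^(N+1) / (1 - w)]. *)
Lemma poisson_truncE z N t : cabs z < 1 ->
  `|poisson z t - poisson_trunc z N t| <= 2 * cabs z ^+ N.+1 / (1 - cabs z).
Proof.
move=> z1; set w := poisson_arg z t.
have d0 : 0 < cabs (1 - w) := poisson_den_gt0 t z1.
have w0 : 1 - w != 0 by apply: contraTneq d0 => ->; rewrite cabs0 ltxx.
have E : poisson z t = complex.Re ((1 + w) / (1 - w)).
  rewrite /poisson -(cabs_poisson_arg z t) -/w !cabs_sqr.
  case: w d0 w0 => x y; rewrite -(ltr_pXn2r (n := 2)) ?nnegrE ?cabs_ge0 //.
  rewrite expr0n cabs_sqr /= => d0 _.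
  have d1 : (1 - x) ^+ 2 + (0 - y) ^+ 2 != 0 by rewrite lt0r_neq0.
  by rewrite !add0r in d1 *; field.
have gs : 1 + 2 * \sum_(j < N) w ^+ j.+1 = (1 + w) / (1 - w) - 2 * w ^+ N.+1 / (1 - w).
  apply: (mulIf w0); rewrite mulrBl !divfK //.
  have : (1 - w) * \sum_(j < N) w ^+ j.+1 = w - w ^+ N.+1.
    elim: (N) => [|n IH]; first by rewrite big_ord0 mulr0 expr1 subrr.
    by rewrite big_ord_recr /= mulrDr IH mulrBl mul1r -exprS; ring.
  by move=> e; rewrite mulrDl mul1r -mulrA (mulrC _ (1 - w)) e; ring.
rewrite /poisson_trunc -/w gs E -ReN -ReD opprB addrC subrK.
apply: le_trans (Re_cabs _) _; rewrite cabsM cabsV cabsM cabsX cabs_poisson_arg (cabs_nat R 2).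
apply: ler_pM => //.
- by rewrite mulr_ge0 // exprn_ge0 // cabs_ge0.
- by rewrite invr_ge0 cabs_ge0.
rewrite lef_pV2 ?posrE // ?subr_gt0 //.
have := cabsD (1 - w) w; rewrite subrK cabs1 cabs_poisson_arg; lra.
Qed.

Lemma poisson_trunc_real z N t :
  poisson_trunc z N t = complex.Re (1 : C) + \sum_(j < N) complex.Re (2 * z ^+ j.+1 *
    (expi t ^+ 0 * conjc (expi t ^+ j.+1))).
Proof.
rewrite /poisson_trunc ReD mulr_sumr Re_sum; congr (_ + _); apply: eq_bigr => j _.
by rewrite /poisson_arg exprMn expr0 mul1r rmorphXn /= mulrA.
Qed.

Lemma continuous_poisson_trunc z N : continuous (poisson_trunc z N).
Proof.
have -> : poisson_trunc z N = fun t => complex.Re (1 : C) +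
    \sum_(j < N) complex.Re (2 * z ^+ j.+1 * (expi t ^+ 0 * conjc (expi t ^+ j.+1))).
  by apply/funext => t; apply: poisson_trunc_real.
move=> t; apply: cvgD; first exact: cvg_cst.
apply: (@continuous_sum R N (fun j t => complex.Re (2 * z ^+ j.+1 *
  (expi t ^+ 0 * conjc (expi t ^+ j.+1))))) => j.
under eq_fun do rewrite expi_freq.
exact: continuous_trig.
Qed.

Lemma cvg_expr_dist (r c : R) : 0 <= r < 1 ->
  (fun N => c * r ^+ N.+1 / (1 - r)) @ \oo --> (0 : R).
Proof.
move=> /andP[r0 r1].
have -> : (fun N => c * r ^+ N.+1 / (1 - r)) = (fun N => (c * r / (1 - r)) * r ^+ N).
  by apply/funext => N; rewrite exprS; ring.
rewrite -[X in _ --> X](mulr0 (c * r / (1 - r))).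
by apply: cvgM; [apply: cvg_cst | apply: cvg_expr; rewrite ger0_norm].
Qed.

Lemma L1_poisson z f : cabs z < 1 -> L1 f -> L1 (fun t => f t * poisson z t).
Proof.
move=> z1 hf; have := L1_mulc (continuous_poisson z1) hf.
by under eq_fun do rewrite mulrC.
Qed.

(** The truncated kernels converge uniformly in [t], so the means converge for every integrable
    [f]. *)
Lemma mean_poisson_unique z f l : cabs z < 1 -> L1 f ->
  (fun N => mean (fun t => f t * poisson_trunc z N t)) @ \oo --> l ->
  mean (fun t => f t * poisson z t) = l.
Proof.
move=> z1 hf hl; apply/esym; apply: cvg_unique hl _ => //.
have h N : `|mean (fun t => f t * poisson z t) -
    mean (fun t => f t * poisson_trunc z N t)| <=
    2 * mean (fun t => `|f t|) * cabs z ^+ N.+1 / (1 - cabs z).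
  have hT : L1 (fun t => f t * poisson_trunc z N t).
    have := L1_mulc (@continuous_poisson_trunc z N) hf.
    by under eq_fun do rewrite mulrC.
  have hP := L1_poisson z1 hf.
  have -> : mean (fun t => f t * poisson z t) - mean (fun t => f t * poisson_trunc z N t)
      = mean (fun t => f t * poisson z t + -1 * (f t * poisson_trunc z N t)).
    by rewrite meanD ?meanZ ?mulN1r //; apply: L1Z.
  have hD := L1D hP (L1Z (-1) hT).
  apply: le_trans (mean_norm hD) _.
  rewrite -[2 * mean _ * _]mulrA [mean _ * _]mulrC mulrA -mulrA [mean _ * _]mulrC mulrA.
  rewrite -meanZ; last exact: L1_norm.
  apply: mean_le; [exact: L1_norm | by apply: L1Z; apply: L1_norm|].
  move=> t; rewrite mulN1r -mulrBr normrM mulrC ler_wpM2r // poisson_truncE //.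
have z01 : 0 <= cabs z < 1 by rewrite cabs_ge0.
have c0 := cvg_expr_dist (2 * mean (fun t => `|f t|)) z01.
apply/cvgrPdist_lt => e e0; move/cvgr0Pnorm_lt : c0 => /(_ _ e0).
by apply: filterS => N /=; apply: le_lt_trans; apply: le_trans (h N) (ler_norm _).
Qed.

Lemma mean_mono_poisson (c : C) k z : cabs z < 1 ->
  L1 (fun t => complex.Re (c * expi t ^+ k)) /\
  mean (fun t => complex.Re (c * expi t ^+ k) * poisson z t) = complex.Re (c * z ^+ k).
Proof.
move=> z1.
have L : L1 (fun t => complex.Re (c * expi t ^+ k)).
  by have := (mean_freq c k 0).1; under eq_fun do rewrite expr0 conjc1 mulr1.
split=> //; apply: mean_poisson_unique => //.
(* Once [N >= k] the truncated kernel reproduces the monomial exactly, since its higher frequencies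
   are orthogonal to it. *)
suff h N : (k <= N)%N -> mean (fun t => complex.Re (c * expi t ^+ k) *
    poisson_trunc z N t) = complex.Re (c * z ^+ k).
  apply/cvgrPdist_lt => e e0; exists k => // N /= /h ->.
  by rewrite subrr normr0.
move=> kN.
(* Product-to-sum formula: only the frequencies [k - p] and [k + p] occur in [T p b]. *)
have RR (a b : C) : complex.Re a * complex.Re b =
    2^-1 * complex.Re (a * b) + 2^-1 * complex.Re (a * conjc b).
  by rewrite !ReM Re_conj Im_conj; field.
pose T (p : nat) (b : C) t := complex.Re (c * expi t ^+ k) *
  complex.Re (b * (expi t ^+ 0 * conjc (expi t ^+ p))).
have hT p b : L1 (T p b) /\ mean (T p b) =
    2^-1 * ((k == p)%:R * complex.Re (c * b)) +
    2^-1 * ((k + p == 0)%N%:R * complex.Re (c * conjc b)).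
  have -> : T p b = fun t =>
      2^-1 * complex.Re (c * b * (expi t ^+ k * conjc (expi t ^+ p))) +
      2^-1 * complex.Re (c * conjc b * (expi t ^+ (k + p) * conjc (expi t ^+ 0))).
    apply/funext => t; rewrite /T RR expr0 mul1r conjc1 mulr1 exprD.
    congr (_ * complex.Re _ + _ * complex.Re _); first by rewrite mulrACA.
    by rewrite rmorphM /= conjcK mulrACA.
  have [a1 a2] := mean_freq (c * b) k p; have [b1 b2] := mean_freq (c * conjc b) (k + p) 0.
  by split; [apply: L1D; apply: L1Z | rewrite meanD ?meanZ ?a2 ?b2 //; apply: L1Z].
have -> : (fun t => complex.Re (c * expi t ^+ k) * poisson_trunc z N t) =
    fun t => T 0%N 1 t + \sum_(j < N) T j.+1 (2 * z ^+ j.+1) t.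
  apply/funext => t; rewrite poisson_trunc_real mulrDr mulr_sumr; congr (_ + _).
  by rewrite /T expr0 conjc1 !mulr1.
have [s1 s2] := mean_sum N (fun j => (hT j.+1 (2 * z ^+ j.+1)).1).
rewrite meanD ?s2 ?(hT _ _).2 //; last exact: (hT _ _).1.
under eq_bigr => j _ do rewrite (hT _ _).2 addnS /= mul0r mulr0 addr0.
rewrite addn0 conjc1 mulr1.
(* For [k = 0] both frequencies of the constant term are 0 and the two halves add up. For [k > 0]
   only [p = k] survives, and the factor 2 of the kernel cancels the one half. *)
case: k kN {L T hT s1 s2} => [|k] kN.
  rewrite big1 ?addr0 => [|j _]; last by rewrite mul0r mulr0.
  by rewrite /= expr0 mulr1; field.
rewrite /= !mul0r !mulr0 !add0r (bigD1 (Ordinal kN)) //= eqxx mul1r big1 ?addr0.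
  by rewrite mulrCA mulr_natl mulr2n ReD; field.
move=> j; rewrite -val_eqE /= eqSS eq_sym => /negbTE ->.
by rewrite mul0r mulr0.
Qed.

Lemma mean_poisson1 z : cabs z < 1 -> mean (poisson z) = 1.
Proof.
move=> z1; have [_] := mean_mono_poisson 1 0 z1.
rewrite expr0 mul1r /= => <-; congr mean; apply/funext => t.
by rewrite mul1r.
Qed.

Lemma L1_cabs_poly N (p : nat -> C) :
  L1 (fun t => cabs (\sum_(k < N) p k * expi t ^+ k)).
Proof.
apply: L1_cont.
have -> : (fun t => cabs (\sum_(k < N) p k * expi t ^+ k)) = fun t : R => Num.sqrt (
   (\sum_(k < N) complex.Re (p k * expi (k%:R * t))) ^+ 2 +
   (\sum_(k < N) complex.Re (- 'i%C * p k * expi (k%:R * t))) ^+ 2).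
  apply/funext => t; rewrite /cabs Re_sum Im_sum.
  congr (Num.sqrt (_ ^+ 2 + _ ^+ 2)); apply: eq_bigr => k _; rewrite expiX //.
  by rewrite -mulrA [RHS]ReM /= oppr0 mul0r sub0r mulN1r opprK.
have cs (q : nat -> C) : continuous (fun t : R => \sum_(k < N) complex.Re (q k * expi (k%:R * t))).
  by apply: (@continuous_sum R N (fun k t => complex.Re (q k * expi (k%:R * t)))) => k;
    apply: continuous_trig.
move=> t; apply: continuous_comp; last exact: sqrt_continuous.
have c1 := cs p; have c2 := cs (fun k => - 'i%C * p k).
by apply: cvgD; rewrite expr2; under eq_fun do rewrite expr2;
  [exact: cvgM (c1 t) (c1 t) | exact: cvgM (c2 t) (c2 t)].
Qed.

(** Rotate by [c] so that [c p(z)] becomes its modulus. The real part of [c p] is reproduced by the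
    Poisson kernel and is at most [|p|] on the circle. *)
Lemma poly_poisson_le N (p : nat -> C) z : cabs z < 1 ->
  cabs (\sum_(k < N) p k * z ^+ k) <=
  mean (fun t => cabs (\sum_(k < N) p k * expi t ^+ k) * poisson z t).
Proof.
move=> z1; have hL := L1_cabs_poly N p.
have [c c1 <-] := rotate_to_norm (\sum_(k < N) p k * z ^+ k).
have hk k := mean_mono_poisson (c * p k) k z1.
have [s1 s2] := mean_sum N (fun k => L1_poisson z1 (hk k).1).
rewrite mulr_sumr Re_sum.
under eq_bigr => k _ do rewrite mulrA -(hk k).2.
rewrite -s2; apply: mean_le => //; first exact: L1_poisson.
move=> t; rewrite -mulr_suml ler_wpM2r ?poisson_ge0 // -Re_sum.
under eq_bigr => k _ do rewrite -mulrA.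
by rewrite -mulr_sumr (le_trans (ler_Re_cabs _)) // cabsM c1 mul1r.
Qed.
End PoissonKernel.

(** * Bounded analytic functions and the pairing of H2 *)

Section BoundedFunctions.
Variable R : realType.
Local Notation C := R[i].
Implicit Types (a f g h x : nat -> C) (z : C) (r s M : R).

Definition Hinf_le M f := bdisc f /\ forall z, cabs z < 1 -> cabs (ev f z) <= M.

Lemma Hinf_le_ge0 M f : Hinf_le M f -> 0 <= M.
Proof. by move=> [_ /(_ 0)]; rewrite cabs0 => /(_ ltr01); apply: le_trans; apply: cabs_ge0. Qed.

Lemma Hinf_le_le M M' f : M <= M' -> Hinf_le M f -> Hinf_le M' f.
Proof. by move=> MM [h1 h2]; split=> // z /h2 /le_trans; apply. Qed.

(** Parseval's identity for the Taylor polynomials on the circle of radius [r]. The truncation error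
    [e N] is uniform on that circle and tends to 0. *)
Lemma sqr_sum_dilate M f n r : Hinf_le M f -> 0 <= r < 1 ->
  \sum_(k < n) (cabs (f k) * r ^+ k) ^+ 2 <= M ^+ 2.
Proof.
move=> hf /andP[r0 r1].
have hs : cvgn (series (fun k => cabs (f k) * r ^+ k)).
  by apply: summable_disc (hf.1) _; rewrite r0.
pose e N := tail (fun k => cabs (f k) * r ^+ k) N.
have key N : (n <= N)%N ->
    \sum_(k < n) (cabs (f k) * r ^+ k) ^+ 2 <= (M + e N) ^+ 2.
  move=> nN; pose s k := f k * (Complex r 0) ^+ k.
  have sE k : cabs (s k) = cabs (f k) * r ^+ k by rewrite cabsM cabsX cabs_realc.
  apply: (@le_trans _ _ (\sum_(k < N) cabs (s k) ^+ 2)).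
    under eq_bigr => k _ do rewrite -sE.
    rewrite -!(big_mkord xpredT (fun k => cabs (s k) ^+ 2)) (big_cat_nat (leq0n n) nN) /=.
    by rewrite lerDl sumr_ge0 // => k _; rewrite sqr_ge0.
  have [p1 <-] := parseval N s.
  rewrite -[leRHS](@mean_cst R); apply: mean_le => //.
    by apply: L1_cont => t; apply: cvg_cst.
  move=> t; have zr : cabs (Complex r 0 * expi t) = r.
    by rewrite cabsM cabs_expi mulr1 cabs_realc.
  have zr' : cabs (Complex r 0 * expi t) <= r by rewrite zr.
  have h1 := csum_tail N (bdisc_dominated hf.1 zr' r1).
  have h2 : cabs (ev f (Complex r 0 * expi t)) <= M by apply: hf.2; rewrite zr.
  have -> : \sum_(k < N) s k * expi t ^+ k =
      \sum_(k < N) f k * (Complex r 0 * expi t) ^+ k.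
    by apply: eq_bigr => k _; rewrite /s exprMn mulrA.
  rewrite ler_sqr ?nnegrE ?cabs_ge0 //.
    have := cabs_triangle (\sum_(k < N) f k * (Complex r 0 * expi t) ^+ k) 0
      (ev f (Complex r 0 * expi t)).
    by rewrite !subr0 cabsBC; rewrite /ev in h2 *; rewrite /e; lra.
  have := Hinf_le_ge0 hf.
  have := cabs_ge0 (csum (fun k : nat => f k * (Complex r 0 * expi t) ^+ k) -
        \sum_(k < N) f k * (Complex r 0 * expi t) ^+ k).
  by rewrite /e; lra.
have lim : (fun N => (M + e N) ^+ 2) @ \oo --> (M + 0) ^+ 2.
  rewrite expr2; under eq_fun do rewrite expr2.
  have := tail_cvg0 hs => h0.
  by apply: cvgM; apply: cvgD => //; apply: cvg_cst.
rewrite addr0 in lim; apply: (ler_cvg_to (cvg_cst _) lim).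
by exists n => // N /= nN; apply: key.
Qed.

(** Let the radius tend to 1 in a finite sum. This gives both the coefficient bound that makes
    Montel's theorem work and the inclusion of bounded functions in [inH2]. *)
Lemma Hinf_le_sqr_sum M f n : Hinf_le M f -> \sum_(k < n) cabs (f k) ^+ 2 <= M ^+ 2.
Proof.
move=> hf.
have lim : (fun m => \sum_(k < n) (cabs (f k) * (1 - harmonic m) ^+ k) ^+ 2)
    @ \oo --> \sum_(k < n) (cabs (f k) * (1 - 0) ^+ k) ^+ 2.
  have hh : (fun m => 1 - harmonic m : R) @ \oo --> (1 - 0 : R).
    by apply: cvgB; [apply: cvg_cst | apply: cvg_harmonic].
  elim: n => [|n IH].
    by rewrite big_ord0; under eq_fun do rewrite big_ord0; apply: cvg_cst.
  rewrite big_ord_recr; under eq_fun do rewrite big_ord_recr.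
  have hx : (fun m => cabs (f n) * (1 - harmonic m) ^+ n) @ \oo -->
      cabs (f n) * (1 - 0) ^+ n.
    apply: cvgM; first exact: cvg_cst.
    elim: (n) => [|j IHj]; first exact: cvg_cst.
    by rewrite exprS; under eq_fun do rewrite exprS; apply: cvgM.
  apply: cvgD => //=; rewrite expr2; under eq_fun do rewrite expr2.
  exact: cvgM.
have -> : \sum_(k < n) cabs (f k) ^+ 2 = \sum_(k < n) (cabs (f k) * (1 - 0) ^+ k) ^+ 2.
  by apply: eq_bigr => k _; rewrite subr0 expr1n mulr1.
apply: (ler_cvg_to lim (cvg_cst _)).
apply: nearW => m; apply: sqr_sum_dilate => //.
rewrite /harmonic /= subr_ge0 invf_le1 ?ltr0n // ler1n /=.
by rewrite ltrBlDr ltrDl invr_gt0 ltr0n.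
Qed.

Lemma Hinf_le_coef M f k : Hinf_le M f -> cabs (f k) <= M.
Proof.
move=> hf; have := Hinf_le_sqr_sum k.+1 hf; rewrite big_ord_recr /= => h.
rewrite -ler_sqr ?nnegrE ?cabs_ge0 ?(Hinf_le_ge0 hf) //.
by apply: le_trans h; rewrite lerDr sumr_ge0 // => i _; rewrite sqr_ge0.
Qed.

(** The difference is bounded by 0 on the disc, hence so are its coefficients. *)
Lemma ev_inj f g : bdisc f -> bdisc g ->
  (forall z, cabs z < 1 -> ev f z = ev g z) -> f = g.
Proof.
move=> hf hg h; apply/funext => k.
have [b e] := ev_sub hf hg.
have h0 : Hinf_le 0 (fun k => f k - g k).
  by split=> // z z1; rewrite e // h // subrr cabs0.
have := Hinf_le_coef k h0; have := cabs_ge0 (f k - g k) => h1 h2.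
by apply/eqP; rewrite -subr_eq0; apply/eqP/cabs_eq0; lra.
Qed.

Lemma Hinf_le_Toep M M' a f : Hinf_le M a -> Hinf_le M' f -> Hinf_le (M * M') (Toep a f).
Proof.
move=> ha hf; have [b e] := ev_Toep ha.1 hf.1; split=> // z z1.
by rewrite e // cabsM; apply: ler_pM; rewrite ?cabs_ge0 //; [exact: ha.2 | exact: hf.2].
Qed.

Lemma Hinf_le_iter_Toep M M' m a f : Hinf_le M a -> Hinf_le M' f ->
  Hinf_le (M ^+ m * M') (iter m (Toep a) f).
Proof.
move=> ha hf; elim: m => [|m IH]; first by rewrite mul1r.
by rewrite exprS -mulrA iterS; apply: Hinf_le_Toep.
Qed.

Lemma Hinf_le_mono j : Hinf_le 1 (mono R j).
Proof.
have [b e] := ev_mono R j; split=> // z z1.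
by rewrite e // cabsX exprn_ile1 ?cabs_ge0 // ltW.
Qed.

Section CoefficientwiseLimits.
Context (F : set_system nat) {FF : ProperFilter F}.

(** All coefficients are at most [M], so a geometric series dominates at each point and
    coefficientwise limits become pointwise ones. *)
Lemma Hinf_le_lim M (f : nat -> nat -> C) g : (forall n, Hinf_le M (f n)) ->
  (forall k, Clim F (f^~ k) (g k)) ->
  Hinf_le M g /\ forall z, cabs z < 1 -> Clim F (fun n => ev (f n) z) (ev g z).
Proof.
move=> hf hg.
have bg k : cabs (g k) <= M by apply: (Clim_le (hg k)) => n; apply: Hinf_le_coef.
have M0 : 0 <= M := Hinf_le_ge0 (hf 0%N).
have bdg : bdisc g.
  move=> r /andP[r0 r1]; exists M => k; rewrite -[leRHS]mulr1.
  by apply: ler_pM; rewrite ?cabs_ge0 ?exprn_ge0 ?exprn_ile1 // ltW.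
have lim z : cabs z < 1 -> Clim F (fun n => ev (f n) z) (ev g z).
  move=> z1; have d n : dominated (fun k => f n k * z ^+ k) (geometric M (cabs z)).
    split=> [k|]; last by apply: is_cvg_geometric_series; rewrite ger0_norm ?cabs_ge0.
    by rewrite cabsM cabsX /geometric /= ler_wpM2r ?exprn_ge0 ?cabs_ge0 // Hinf_le_coef.
  apply: (tannery _ d _).2 => k.
  by apply: ClimM => //; apply: Clim_cst.
split=> //; split=> // z z1; apply: (Clim_le (lim z z1)) => n; exact: (hf n).2.
Qed.

Lemma Clim_Toep a (f : nat -> nat -> C) g :
  (forall k, Clim F (f^~ k) (g k)) ->
  forall k, Clim F (fun n => Toep a (f n) k) (Toep a g k).
Proof.
move=> h k; rewrite /Toep.
apply: (@Clim_sum _ _ _ _ (fun n i => a i * f n (k - i)%N) (fun i => a i * g (k - i)%N)).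
by move=> i _; apply: ClimM => //; apply: Clim_cst.
Qed.
End CoefficientwiseLimits.

Lemma montel (U : set_system nat) (UU : UltraFilter U) M (f : nat -> nat -> C) :
  (forall n, Hinf_le M (f n)) ->
  exists g, [/\ Hinf_le M g, forall k, Clim U (f^~ k) (g k) &
    forall z, cabs z < 1 -> Clim U (fun n => ev (f n) z) (ev g z)].
Proof.
move=> hf.
have /choice [g hg] : forall k, exists l, Clim U (f^~ k) l.
  by move=> k; apply: (@ultra_Clim _ _ _ _ M) => n; apply: Hinf_le_coef.
by exists g; have [h1 h2] := Hinf_le_lim hf hg.
Qed.
End BoundedFunctions.

(** * The pairing of [H2] and its continuity *)

Section InnerProduct.
Variable R : realType.
Local Notation C := R[i].
Implicit Types (f g x y : nat -> C) (M : R).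

Definition ip x y : C := csum (fun k => x k * conjc (y k)).

Lemma Hinf_le_inH2 M f : Hinf_le M f -> inH2 f.
Proof.
move=> hf; apply: nondecreasing_is_cvgn.
  by apply: nondecreasing_series => // k _; rewrite sqr_ge0.
exists (M ^+ 2) => _ [n _ <-]; rewrite /series /= big_mkord; exact: Hinf_le_sqr_sum.
Qed.

(** Takes the place of the Cauchy-Schwarz inequality. The weight [s] can be tuned to make either
    term small, and the majorant of the pairing stays an explicit series. *)
Lemma amgm (a b s : R) : 0 < s -> a * b <= s * a ^+ 2 + s^-1 * b ^+ 2.
Proof.
move=> s0; rewrite -subr_ge0.
have -> : s * a ^+ 2 + s^-1 * b ^+ 2 - a * b = s^-1 * ((s * a - b / 2) ^+ 2 + 3 / 4 * b ^+ 2).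
  by field; rewrite lt0r_neq0.
by rewrite mulr_ge0 ?invr_ge0 ?(ltW s0) // addr_ge0 ?sqr_ge0 // mulr_ge0 ?sqr_ge0 // divr_ge0.
Qed.

Lemma series_comb (u v : nat -> R) (s r : R) : cvgn (series u) -> cvgn (series v) ->
  series (fun k => s * u k + r * v k) @ \oo --> s * limn (series u) + r * limn (series v).
Proof.
move=> hu hv; have -> : series (fun k => s * u k + r * v k) =
    fun n => s * series u n + r * series v n.
  by apply/funext => n; rewrite /series /= big_split /= -!mulr_sumr.
by apply: cvgD; apply: cvgM => //; apply: cvg_cst.
Qed.

Lemma ip_dominated (s : R) x y : 0 < s -> inH2 x -> inH2 y ->
  dominated (fun k => x k * conjc (y k)) (fun k => s * cabs (x k) ^+ 2 + s^-1 * cabs (y k) ^+ 2).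
Proof.
move=> s0 hx hy; split=> [k|]; first by rewrite cabsM cabs_conj amgm.
by apply/cvg_ex; eexists; apply: series_comb.
Qed.

Lemma ip_cvg x y : inH2 x -> inH2 y -> cconv (fun k => x k * conjc (y k)) (ip x y).
Proof. by move=> hx hy; apply: dominated_cvg (ip_dominated ltr01 hx hy). Qed.

Lemma ip_unique x y l : Ccvg (inner_psum x y) l -> ip x y = l.
Proof. by move=> /CcvgE h; apply: csum_unique. Qed.

Lemma ip_conj x y : inH2 x -> inH2 y -> ip y x = conjc (ip x y).
Proof.
move=> hx hy; apply: csum_unique; have := cconv_conj (ip_cvg hx hy).
by under eq_fun do rewrite rmorphM /= conjcK mulrC.
Qed.

Lemma ip_bound x y (s : R) : 0 < s -> inH2 x -> inH2 y ->
  cabs (ip x y) <= s * H2norm x ^+ 2 + s^-1 * H2norm y ^+ 2.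
Proof.
move=> s0 hx hy; apply: le_trans (cabs_csum (ip_dominated s0 hx hy)) _.
have e (u : nat -> C) : inH2 u -> H2norm u ^+ 2 = limn (series (fun k => cabs (u k) ^+ 2)).
  move=> hu; rewrite /H2norm sqr_sqrtr //; apply: limr_ge => //.
  by apply: nearW => n; rewrite /series /= sumr_ge0 // => k _; rewrite sqr_ge0.
by rewrite !e // (cvg_lim _ (series_comb hx hy)).
Qed.

Lemma ip_sum N (c : nat -> C) (f : nat -> nat -> C) x : (forall i, inH2 (f i)) -> inH2 x ->
  ip (fun k => \sum_(i < N) c i * f i k) x = \sum_(i < N) c i * ip (f i) x.
Proof.
move=> hf hx; apply: csum_unique; elim: N => [|N IH].
  rewrite big_ord0; under eq_fun do rewrite big_ord0 mul0r; exact: cconv0.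
rewrite big_ord_recr; under eq_fun do rewrite big_ord_recr mulrDl -mulrA.
by apply: cconvD => //; apply: cconvZ; apply: ip_cvg.
Qed.

Lemma ip_lim (F : set_system nat) (FF : ProperFilter F) M (f : nat -> nat -> C) g x :
  (forall n, Hinf_le M (f n)) -> (forall k, Clim F (f^~ k) (g k)) -> inH2 x ->
  Clim F (fun n => ip (f n) x) (ip g x).
Proof.
move=> hf hg hx; have [hbg _] := Hinf_le_lim hf hg.
apply: (@Clim_uniform_tail _ _ _ (fun n k => f n k * conjc (x k)) (fun k => g k * conjc (x k))).
  by move=> k; apply: ClimM => //; apply: Clim_cst.
move=> e e0.
have M1 : 0 < M ^+ 2 + 1 by rewrite ltr_wpDl ?sqr_ge0.
(* The term with [f n] has no small tail uniformly in [n], so [s] makes it at most [e / 2] from the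
   bound [M ^+ 2] alone; [K] then makes the tail of [x] beat the factor [s^-1]. *)
pose s := e / 2 / (M ^+ 2 + 1).
have s0 : 0 < s by rewrite !divr_gt0.
have [K hK] : exists K, tail (fun k => cabs (x k) ^+ 2) K < s * e / 2.
  by apply: tail_small => //; rewrite divr_gt0 // mulr_gt0.
have key h : Hinf_le M h -> cabs (ip h x - \sum_(k < K) h k * conjc (x k)) <= e.
  move=> hh; apply: le_trans (csum_tail K (ip_dominated s0 (Hinf_le_inH2 hh) hx)) _.
  have -> : tail (fun k => s * cabs (h k) ^+ 2 + s^-1 * cabs (x k) ^+ 2) K =
     s * tail (fun k => cabs (h k) ^+ 2) K + s^-1 * tail (fun k => cabs (x k) ^+ 2) K.
    rewrite /tail (cvg_lim _ (series_comb (Hinf_le_inH2 hh) hx)) //.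
    have -> : series (fun k => s * cabs (h k) ^+ 2 + s^-1 * cabs (x k) ^+ 2) K =
        s * series (fun k => cabs (h k) ^+ 2) K + s^-1 * series (fun k => cabs (x k) ^+ 2) K.
      by rewrite /series /= big_split /= -!mulr_sumr.
    ring.
  have t1 : tail (fun k => cabs (h k) ^+ 2) K <= M ^+ 2 + 1.
    apply: (@le_trans _ _ (limn (series (fun k => cabs (h k) ^+ 2)))).
      by rewrite /tail lerBlDr lerDl /series /= sumr_ge0 // => k _; rewrite sqr_ge0.
    apply: (@le_trans _ _ (M ^+ 2)); last by rewrite lerDl.
    apply: limr_le; first exact: Hinf_le_inH2 hh.
    by apply: nearW => n; rewrite /series /= big_mkord Hinf_le_sqr_sum.
  have t2 : s * tail (fun k => cabs (h k) ^+ 2) K <= e / 2.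
    apply: le_trans (ler_wpM2l (ltW s0) t1) _.
    by rewrite /s divfK // lt0r_neq0.
  have t3 : s^-1 * tail (fun k => cabs (x k) ^+ 2) K <= e / 2.
    by rewrite mulrC ler_pdivrMr // mulrC mulrA ltW.
  lra.
by exists K; split=> [|n]; apply: key.
Qed.
End InnerProduct.

(** * Inverses and exponentials of power series *)

Section HolomorphicConstructions.
Variable R : realType.
Local Notation C := R[i].
Implicit Types (a b c f g h Q : nat -> C) (z w : C) (r s M : R).

Lemma exists_ultra : exists2 U : set_system nat, UltraFilter U & \oo `<=` U.
Proof.
pose proof (@ultraFilterLemma nat \oo _) as [U [h1 h2]].
by exists U.
Qed.

Lemma cvg_ultra (U : set_system nat) (u : nat -> R) (l : R) :
  \oo `<=` U -> u @ \oo --> l -> u @ U --> l.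
Proof. by move=> oU h A /h; apply: oU. Qed.

Definition rad (n : nat) : R := 1 - harmonic n.

Lemma rad01 n : 0 <= rad n < 1.
Proof.
rewrite /rad /harmonic /= subr_ge0 invf_le1 ?ltr0n // ler1n /=.
by rewrite ltrBlDr ltrDl invr_gt0 ltr0n.
Qed.

Lemma rad_le1 n : 0 <= rad n <= 1.
Proof. by have /andP[-> /ltW ->] := rad01 n. Qed.

Lemma rad_cvg : rad @ \oo --> (1 : R).
Proof.
rewrite -[X in _ --> X]subr0; apply: cvgB; [exact: cvg_cst | exact: cvg_harmonic].
Qed.

Lemma lt_eighth_twice (T : R) : T < 8^-1 -> T + (4^-1 + T) <= 2^-1.
Proof. lra. Qed.

(** * Inverting a function of modulus at least 1 by a continuity method *)

Section Inverse.
Variables (a : nat -> C).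
Hypotheses (ha : bdisc a) (a1 : forall z, cabs z < 1 -> 1 <= cabs (ev a z)).

(** Invertibility of the dilate of [a] by [s], with an inverse bounded by 1. It is trivial at
    [s = 0], where the dilate is constant, and is carried to larger [s] in small steps. *)
Let Inv s := exists b, Hinf_le 1 b /\
  forall z, cabs z < 1 -> ev b z * ev a (Complex s 0 * z) = 1.

Lemma inverse_base : Inv 0.
Proof.
have a0 : 1 <= cabs (ev a 0) by apply: a1; rewrite cabs0.
have n0 : ev a 0 != 0 by apply: contraTneq a0 => ->; rewrite cabs0 -ltNge ltr01.
have [m1 m2] := ev_mono R 0; have [b1 b2] := ev_scale (ev a 0)^-1 m1.
exists (fun k => (ev a 0)^-1 * mono R 0 k).
have E z : cabs z < 1 -> ev (fun k => (ev a 0)^-1 * mono R 0 k) z = (ev a 0)^-1.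
  by move=> z1; rewrite b2 // m2 // mulr1.
split=> [|z z1]; last by rewrite E // mul0r mulVf.
split=> // z z1; rewrite E // cabsV invf_le1 //; exact: lt_le_trans a0.
Qed.

(* With [c = (a_r - a_s) b], the inverse of [a_r] solves [f (1 + c) = b]; it is the limit
   of the iteration [f <- b - c f], which contracts because [|c| <= 1/2]. *)
Lemma inverse_step s r : 0 <= s <= 1 -> 0 <= r <= 1 -> Inv s ->
  (forall z, cabs z < 1 ->
     cabs (ev a (Complex r 0 * z) - ev a (Complex s 0 * z)) <= 2^-1) -> Inv r.
Proof.
move=> s01 r01 [b [hbb bE]] hd.
have [as1 as2] := ev_dilate s01 ha; have [ar1 ar2] := ev_dilate r01 ha.
pose D k := dilate r a k - dilate s a k.
have [D1 D2] := ev_sub ar1 as1.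
have hD : Hinf_le 2^-1 D by split=> // z z1; rewrite D2 // ar2 // as2 // hd.
pose c := Toep D b; have hc : Hinf_le (2^-1 * 1) c := Hinf_le_Toep hD hbb.
have [c1 c2] := ev_Toep D1 hbb.1; rewrite -/c in c1 c2.
pose f n := iter n (fun u k => b k - Toep c u k) b.
have fS n : bdisc (f n) -> bdisc (f n.+1) /\
    forall z, cabs z < 1 -> ev (f n.+1) z = ev b z - ev c z * ev (f n) z.
  move=> fn; have [t1 t2] := ev_Toep c1 fn; have [u1 u2] := ev_sub hbb.1 t1.
  by split=> // z z1; rewrite u2 // t2.
have hf n : Hinf_le 2 (f n).
  elim: n => [|n IH]; first by apply: Hinf_le_le hbb; rewrite ler1n.
  have [u1 u2] := fS n IH.1; split=> // z z1; rewrite u2 //.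
  apply: le_trans (cabsB _ _) _; rewrite cabsM.
  have h1 := hbb.2 z z1; have h2 := hc.2 z z1; have h3 := IH.2 z z1.
  have h4 : cabs (ev c z) * cabs (ev (f n) z) <= 2^-1 * 2.
    by apply: ler_pM; rewrite ?cabs_ge0 // -[leRHS]mulr1.
  rewrite mulVf // in h4; lra.
(* Each iteration multiplies the residual of the equation [f (1 + c) = b] by [- c]. *)
have err n z : cabs z < 1 -> cabs (ev (f n) z * (1 + ev c z) - ev b z) <= 2^-1 ^+ n.
  move=> z1; elim: n => [|n IH].
    rewrite mulrDr mulr1 addrAC subrr add0r cabsM expr0 -[leRHS]mulr1.
    apply: ler_pM; [exact: cabs_ge0 | exact: cabs_ge0 | exact: hbb.2 |].
    by apply: le_trans (hc.2 z z1) _; rewrite mulr1 invf_le1 // ler1n.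
  rewrite (fS n (hf n).1).2 //.
  have -> : (ev b z - ev c z * ev (f n) z) * (1 + ev c z) - ev b z =
    - (ev c z * (ev (f n) z * (1 + ev c z) - ev b z)) by ring.
  rewrite cabsN cabsM exprS; apply: ler_pM; rewrite ?cabs_ge0 //.
  by rewrite -[leRHS]mulr1 hc.2.
have [U UU oU] := exists_ultra.
have [g [hg1 _ hg2]] := montel UU hf.
have gE z : cabs z < 1 -> ev g z * (1 + ev c z) = ev b z.
  move=> z1; apply/eqP; rewrite -subr_eq0; apply/eqP.
  have l1 : Clim U (fun n => ev (f n) z * (1 + ev c z) - ev b z)
      (ev g z * (1 + ev c z) - ev b z).
    by apply: ClimB; [apply: ClimM; [exact: hg2 | exact: Clim_cst] | exact: Clim_cst].
  apply: (Clim_unique l1); apply/Clim_cabs.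
  apply: (@squeeze0 _ _ _ _ (fun n => 2^-1 ^+ n : R)).
    by move=> n; rewrite subr0 cabs_ge0 err.
  by apply: cvg_ultra => //; apply: cvg_expr; rewrite ger0_norm ?invr_ge0 // invf_lt1 // ltr1n.
have gI z : cabs z < 1 -> ev g z * ev a (Complex r 0 * z) = 1.
  move=> z1; have e1 := bE z z1; have e2 := gE z z1.
  have -> : ev a (Complex r 0 * z) = (1 + ev c z) * ev a (Complex s 0 * z).
    have cE : ev c z = (ev a (Complex r 0 * z) - ev a (Complex s 0 * z)) * ev b z.
      by rewrite (c2 z z1) (D2 z z1) (ar2 z z1) (as2 z z1).
    by rewrite cE mulrDl mul1r -mulrA e1 mulr1 addrC subrK.
  by rewrite mulrA e2.
(* The iteration only bounds [g] by 2. The bound 1, which keeps the step size from shrinking, is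
   recovered from [g a_r = 1] and [|a_r| >= 1]. *)
exists g; split=> //; split; first exact: hg1.1.
move=> z z1; have := congr1 (@cabs R) (gI z z1); rewrite cabsM cabs1 => e.
have h : 1 <= cabs (ev a (Complex r 0 * z)).
  by apply: a1; apply: le_lt_trans z1; apply: cabs_dilate.
by have := ler_wpM2l (cabs_ge0 (ev g z)) h; rewrite e mulr1.
Qed.

Lemma exprB_le s r k : 0 <= s -> s <= r -> r <= 1 ->
  `|r ^+ k - s ^+ k| <= k%:R * (r - s).
Proof.
move=> s0 sr r1; have r0 : 0 <= r := le_trans s0 sr.
rewrite ger0_norm; last by rewrite subr_ge0 lerXn2r.
elim: k => [|k IH]; first by rewrite subrr mul0r.
have -> : r ^+ k.+1 - s ^+ k.+1 = r * (r ^+ k - s ^+ k) + (r - s) * s ^+ k.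
  by rewrite !exprS; ring.
have h0 : 0 <= r ^+ k - s ^+ k by rewrite subr_ge0 lerXn2r.
have h1 : r * (r ^+ k - s ^+ k) <= r ^+ k - s ^+ k by rewrite ler_piMl.
have h2 : (r - s) * s ^+ k <= r - s.
  by rewrite ler_piMr ?subr_ge0 // exprn_ile1 // (le_trans sr).
have e : k.+1%:R * (r - s) = k%:R * (r - s) + (r - s) by rewrite -natr1 mulrDl mul1r.
rewrite e; lra.
Qed.

(** The step [d] depends on [r] only and not on the current dilation, so finitely many applications
    of [inverse_step] lead from 0 to [r]. *)
Lemma uniform_dilation r : 0 <= r < 1 -> exists2 d : R, 0 < d &
  forall s s' z, 0 <= s -> s <= s' -> s' <= r -> s' - s <= d -> cabs z < 1 ->
    cabs (ev a (Complex s' 0 * z) - ev a (Complex s 0 * z)) <= 2^-1.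
Proof.
move=> r01; have /andP[r0 r1] := r01.
have hs := summable_disc ha r01.
have e8 : 0 < 8^-1 :> R by rewrite invr_gt0.
have [K hK] := tail_small hs e8.
pose B := \sum_(k < K) cabs (a k) * k%:R.
have B0 : 0 <= B by apply: sumr_ge0 => k _; rewrite mulr_ge0 ?cabs_ge0.
(* [B] is a Lipschitz constant in the dilation parameter for the first [K] terms, which thus move by
   at most 1/4; the two tails cost 1/8 each, 1/2 in total. The [+ 1] covers [B = 0]. *)
exists (4^-1 / (B + 1)); first by rewrite divr_gt0 ?invr_gt0 // ltr_wpDl.
move=> s s' z s0 ss sr sd z1.
have s'0 : 0 <= s' := le_trans s0 ss.
have hz t : 0 <= t -> t <= r -> cabs (Complex t 0 * z) <= r.
  move=> t0 tr; rewrite cabsM cabs_realc // -[leRHS]mulr1.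
  by apply: ler_pM; rewrite ?cabs_ge0 // ltW.
have t1 := csum_tail K (bdisc_dominated ha (hz s' s'0 sr) r1).
have t2 := csum_tail K (bdisc_dominated ha (hz s s0 (le_trans ss sr)) r1).
rewrite -/(ev a _) in t1; rewrite -/(ev a _) in t2.
set P := fun t => \sum_(k < K) a k * (Complex t 0 * z) ^+ k.
have hP : cabs (P s' - P s) <= 4^-1.
  rewrite /P -sumrB; apply: le_trans (cabs_sum _ _) _.
  apply: (@le_trans _ _ (\sum_(k < K) cabs (a k) * k%:R * (s' - s))).
    apply: ler_sum => k _; rewrite -mulrBr cabsM -mulrA ler_wpM2l ?cabs_ge0 //.
    rewrite !exprMn -mulrBl cabsM cabsX.
    have -> : Complex s' 0 ^+ k - Complex s 0 ^+ k = Complex (s' ^+ k - s ^+ k) 0.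
      by rewrite -!(rmorphXn (real_complex R)) -rmorphB.
    rewrite cabs_real -[leRHS]mulr1; apply: ler_pM; rewrite ?exprn_ge0 ?cabs_ge0 //.
      by apply: exprB_le => //; apply: ltW; apply: le_lt_trans r1.
    by rewrite exprn_ile1 ?cabs_ge0 // ltW.
  rewrite -mulr_suml -/B.
  have d0 : 0 <= s' - s by rewrite subr_ge0.
  apply: (@le_trans _ _ ((B + 1) * (s' - s))); first by rewrite ler_wpM2r // lerDl.
  by rewrite mulrC -ler_pdivlMr // ltr_wpDl.
have a2 := cabs_triangle (ev a (Complex s' 0 * z)) (ev a (Complex s 0 * z)) (P s').
have a3 := cabs_triangle (P s') (ev a (Complex s 0 * z)) (P s).
rewrite (cabsBC (P s)) in a3.
apply: le_trans a2 _; apply: le_trans (lerD t1 a3) _.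
apply: le_trans (lerD (lexx _) (lerD hP t2)) _.
exact: lt_eighth_twice hK.
Qed.

Lemma inverse_dilated r : 0 <= r < 1 -> Inv r.
Proof.
move=> r01; have [d d0 hd] := uniform_dilation r01; have /andP[r0 r1] := r01.
have h n s : 0 <= s -> s <= r -> s <= n%:R * d -> Inv s.
  elim: n s => [|n IH] s s0 sr sn.
    have -> : s = 0 by apply/eqP; rewrite eq_le s0 andbT -[leRHS](mul0r d).
    exact: inverse_base.
  pose s' := Num.max 0 (s - d).
  have s'0 : 0 <= s' by rewrite le_max lexx.
  have s's : s' <= s by rewrite ge_max s0 /= gerBl ltW.
  have sd : s - s' <= d by rewrite lerBlDl -lerBlDr le_max lexx orbT.
  have s1 : s <= 1 by apply: ltW; apply: le_lt_trans r1.
  apply: (@inverse_step s' s); rewrite ?s0 ?s'0 ?s1 ?(le_trans s's) //.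
    apply: IH => //; first exact: le_trans sr.
    rewrite ge_max; apply/andP; split; first by rewrite mulr_ge0 // ltW.
    rewrite lerBlDr; have e : n.+1%:R * d = n%:R * d + d by rewrite -natr1 mulrDl mul1r.
    by rewrite -e.
  by move=> z z1; apply: hd.
have [n hn] : exists n : nat, r / d <= n%:R.
  by exists (Num.bound (r / d)); apply/ltW/archi_boundP; rewrite divr_ge0 // ltW.
by apply: (h n) => //; rewrite -ler_pdivrMr.
Qed.

(** The inverses of the dilates are bounded by 1 independently of the radius, so [montel] allows the
    radius to tend to 1. *)
Lemma inverse_series : exists b, Hinf_le 1 b /\
  forall z, cabs z < 1 -> ev b z * ev a z = 1.
Proof.
have /choice [b hbn] : forall n, exists b, Hinf_le 1 b /\
    forall z, cabs z < 1 -> ev b z * ev a (Complex (rad n) 0 * z) = 1.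
  by move=> n; apply: inverse_dilated; apply: rad01.
have [U UU oU] := exists_ultra.
have [g [hg1 _ hg2]] := montel UU (fun n => (hbn n).1).
exists g; split=> // z z1.
have l1 : Clim U (fun n => ev (b n) z * ev a (Complex (rad n) 0 * z)) (ev g z * ev a z).
  apply: ClimM; first exact: hg2.
  have -> : ev a z = ev a (Complex 1 0 * z) by rewrite -[z in LHS]mul1r.
  apply: ev_dilate_cvg => //; first exact: rad_le1.
  by apply: cvg_ultra => //; apply: rad_cvg.
apply: (Clim_unique l1).
have -> : (fun n => ev (b n) z * ev a (Complex (rad n) 0 * z)) = fun=> 1.
  by apply/funext => n; apply: (hbn n).2.
exact: Clim_cst.
Qed.
End Inverse.

(** * Bounded functions in the role of [exp(-Q)] *)

Lemma cabs_1B_le w : cabs (1 - w) <= expR (- complex.Re w + cabs w ^+ 2 / 2).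
Proof.
rewrite -ler_sqr ?nnegrE ?cabs_ge0 ?expR_ge0 // -expRM_natl.
apply: le_trans (expR_ge1Dx _); rewrite !cabs_sqr; case: w => x y /=.
by rewrite le_eqVlt; apply/predU1P; left; field.
Qed.

Lemma pow_1B_dist w n : cabs ((1 - w) ^+ n - 1) <= (1 + cabs w) ^+ n - 1.
Proof.
elim: n => [|n IH]; first by rewrite !expr0 !subrr cabs0.
have -> : (1 - w) ^+ n.+1 - 1 = ((1 - w) ^+ n - 1) - w * (1 - w) ^+ n by rewrite exprS; ring.
have h : cabs ((1 - w) ^+ n) <= (1 + cabs w) ^+ n.
  rewrite cabsX lerXn2r ?nnegrE ?cabs_ge0 ?addr_ge0 ?cabs_ge0 //.
  by have := cabsB 1 w; rewrite cabs1.
apply: le_trans (cabsB _ _) _; rewrite cabsM.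
have := ler_wpM2l (cabs_ge0 w) h.
have -> : (1 + cabs w) ^+ n.+1 = (1 + cabs w) ^+ n + cabs w * (1 + cabs w) ^+ n.
  by rewrite exprS; ring.
lra.
Qed.

(** [h] plays the role of [exp(-Q(rz))], as a limit of the powers [(1 - Q(rz)/n)^n]. By [cabs_1B_le]
    their modulus exceeds [exp(-Re Q(rz))] by at most the factor [exp(|Q(rz)|^2/(2n))], which tends
    to 1 and is bounded because the dilated [Q] is. Only the two estimates needed later are
    recorded. *)
Lemma exp_dilated Q r : bdisc Q -> (forall z, cabs z < 1 -> 0 <= complex.Re (ev Q z)) ->
  0 <= r < 1 -> exists h, bdisc h /\ forall z, cabs z < 1 ->
    cabs (ev h z) <= expR (- complex.Re (ev Q (Complex r 0 * z))) /\
    cabs (ev h z - 1) <= expR (cabs (ev Q (Complex r 0 * z))) - 1.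
Proof.
move=> hQ Q0 r01; have /andP[r0 r1] := r01.
have r01' : 0 <= r <= 1 by rewrite r0 ltW.
have [W W0 hW] := ev_bounded hQ r01.
have {}hW z : cabs z < 1 -> cabs (ev Q (Complex r 0 * z)) <= W.
  move=> z1; apply: hW; rewrite cabsM cabs_realc // -[leRHS]mulr1.
  by apply: ler_pM; rewrite ?cabs_ge0 // ltW.
have {}Q0 z : cabs z < 1 -> 0 <= complex.Re (ev Q (Complex r 0 * z)).
  by move=> z1; apply: Q0; apply: le_lt_trans z1; apply: cabs_dilate.
have [d1 d2] := ev_dilate r01' hQ; have [m1 m2] := ev_mono R 0.
pose u (n : nat) k := mono R 0 k - Complex (n.+1%:R^-1) 0 * dilate r Q k.
have uE n : bdisc (u n) /\ forall z, cabs z < 1 ->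
    ev (u n) z = 1 - Complex (n.+1%:R^-1) 0 * ev Q (Complex r 0 * z).
  have [p1 p2] := ev_scale (Complex (n.+1%:R^-1) 0) d1.
  have [q1 q2] := ev_sub m1 p1.
  by split=> // z z1; rewrite (q2 z z1) (m2 z z1) (p2 z z1) (d2 z z1).
pose f n := iter n.+1 (Toep (u n)) (mono R 0).
have fE n : bdisc (f n) /\ forall z, cabs z < 1 -> ev (f n) z =
    (1 - Complex (n.+1%:R^-1) 0 * ev Q (Complex r 0 * z)) ^+ n.+1.
  have [p1 p2] := ev_iter_Toep n.+1 (uE n).1 m1.
  by split=> // z z1; rewrite (p2 z z1) (m2 z z1) mulr1 ((uE n).2 z z1).
have inv0 n : 0 <= n.+1%:R^-1 :> R by rewrite invr_ge0.
have fb n z : cabs z < 1 -> cabs (ev (f n) z) <=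
    expR (- complex.Re (ev Q (Complex r 0 * z)) +
          cabs (ev Q (Complex r 0 * z)) ^+ 2 / 2 * harmonic n).
  move=> z1; rewrite ((fE n).2 z z1) cabsX.
  apply: le_trans (lerXn2r _ _ _ (cabs_1B_le _)) _; rewrite ?nnegrE ?cabs_ge0 ?expR_ge0 //.
  rewrite -expRM_natl ler_expR cabsM cabs_realc // ReM /= mul0r subr0 exprMn /harmonic /=.
  by rewrite le_eqVlt; apply/predU1P; left; field.
have fd n z : cabs z < 1 -> cabs (ev (f n) z - 1) <=
    expR (cabs (ev Q (Complex r 0 * z))) - 1.
  move=> z1; rewrite ((fE n).2 z z1); apply: le_trans (pow_1B_dist _ _) _.
  rewrite lerD2r cabsM cabs_realc //.
  have {2}-> : cabs (ev Q (Complex r 0 * z)) =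
      n.+1%:R * (n.+1%:R^-1 * cabs (ev Q (Complex r 0 * z))) by rewrite mulVKf.
  rewrite expRM_natl lerXn2r ?nnegrE ?expR_ge0 ?addr_ge0 ?mulr_ge0 ?cabs_ge0 //.
  exact: expR_ge1Dx.
have hf n : Hinf_le (expR (W ^+ 2)) (f n).
  split; first exact: (fE n).1.
  move=> z z1; apply: le_trans (fb n z z1) _; rewrite ler_expR.
  have q0 := Q0 z z1; have hw := hW z z1.
  have h1 : cabs (ev Q (Complex r 0 * z)) ^+ 2 <= W ^+ 2.
    by rewrite ler_sqr ?nnegrE ?cabs_ge0.
  have h2 : cabs (ev Q (Complex r 0 * z)) ^+ 2 / 2 * harmonic n <=
     cabs (ev Q (Complex r 0 * z)) ^+ 2 / 2.
    by rewrite ler_piMr ?divr_ge0 ?sqr_ge0 // /harmonic /= invf_le1 // ler1n.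
  have h3 := sqr_ge0 (cabs (ev Q (Complex r 0 * z))).
  lra.
have [U UU oU] := exists_ultra.
have [g [hg1 _ hg2]] := montel UU hf.
exists g; split; first exact: hg1.1.
move=> z z1; split.
  have l1 : (fun n => expR (- complex.Re (ev Q (Complex r 0 * z)) +
          cabs (ev Q (Complex r 0 * z)) ^+ 2 / 2 * harmonic n)) @ U -->
      expR (- complex.Re (ev Q (Complex r 0 * z)) +
          cabs (ev Q (Complex r 0 * z)) ^+ 2 / 2 * 0).
    apply: continuous_cvg; first exact: continuous_expR.
    apply: cvgD; first exact: cvg_cst.
    by apply: cvgM; [exact: cvg_cst | apply: cvg_ultra => //; apply: cvg_harmonic].
  rewrite mulr0 addr0 in l1.
  apply: (ler_cvg_to (Clim_norm (hg2 z z1)) l1); apply: nearW => n; exact: fb.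
have l1 : Clim U (fun n => ev (f n) z - 1) (ev g z - 1).
  by apply: ClimB; [exact: hg2 | exact: Clim_cst].
by apply: (Clim_le l1) => n; apply: fd.
Qed.

(** As [Re Q >= 0], the functions obtained for the dilates are bounded by 1 whatever the radius, so
    the radius can tend to 1 even when [Q] is unbounded. *)
Lemma exp_series Q : bdisc Q -> (forall z, cabs z < 1 -> 0 <= complex.Re (ev Q z)) ->
  exists h, bdisc h /\ forall z, cabs z < 1 ->
    cabs (ev h z) <= expR (- complex.Re (ev Q z)) /\
    cabs (ev h z - 1) <= expR (cabs (ev Q z)) - 1.
Proof.
move=> hQ Q0.
have /choice [f hf] := fun n => exp_dilated hQ Q0 (rad01 n).
have hb1 n : Hinf_le 1 (f n).
  split; first exact: (hf n).1.
  move=> z z1; apply: le_trans (((hf n).2 z z1).1) _.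
  rewrite -[leRHS]expR0 ler_expR oppr_le0; apply: Q0.
  by apply: le_lt_trans z1; apply: cabs_dilate; apply: rad_le1.
have [U UU oU] := exists_ultra.
have [g [hg1 _ hg2]] := montel UU hb1.
exists g; split; first exact: hg1.1.
move=> z z1.
have lQ : Clim U (fun n => ev Q (Complex (rad n) 0 * z)) (ev Q z).
  have -> : ev Q z = ev Q (Complex 1 0 * z) by rewrite -[z in LHS]mul1r.
  apply: ev_dilate_cvg => //; first exact: rad_le1.
  by apply: cvg_ultra => //; apply: rad_cvg.
split.
  have l1 : (fun n => expR (- complex.Re (ev Q (Complex (rad n) 0 * z)))) @ U -->
      expR (- complex.Re (ev Q z)).
    apply: continuous_cvg; first exact: continuous_expR.
    by apply: cvgN; apply: lQ.1.
  apply: (ler_cvg_to (Clim_norm (hg2 z z1)) l1); apply: nearW => n; exact: ((hf n).2 z z1).1.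
have l1 : Clim U (fun n => ev (f n) z - 1) (ev g z - 1).
  by apply: ClimB; [exact: hg2 | exact: Clim_cst].
have l2 : (fun n => expR (cabs (ev Q (Complex (rad n) 0 * z))) - 1) @ U -->
    expR (cabs (ev Q z)) - 1.
  apply: cvgB; last exact: cvg_cst.
  by apply: continuous_cvg; [exact: continuous_expR | exact: Clim_norm].
apply: (ler_cvg_to (Clim_norm l1) l2); apply: nearW => n; exact: ((hf n).2 z z1).2.
Qed.
End HolomorphicConstructions.

(** * Boundary values and Herglotz integrals *)

Section BoundaryValues.
Variable R : realType.
Local Notation C := R[i].
Local Notation mu := (@lebesgue_measure R).
Local Notation I2pi := (`[0, 2 * pi]%classic : set R).
Implicit Types (f g : R -> R) (z : C).

Lemma mean_dominated (f_ : nat -> R -> R) f g :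
  (forall n, L1 (f_ n)) -> measurable_fun I2pi f -> L1 g ->
  {ae mu, forall t, 0 <= t <= 2 * pi -> (fun n => f_ n t) @ \oo --> f t} ->
  (forall n t, `|f_ n t| <= g t) ->
  L1 f /\ (fun n => mean (f_ n)) @ \oo --> mean f.
Proof.
move=> hf mf hg hc hle.
have m1 n : measurable_fun I2pi (EFin \o f_ n) := measurable_int _ (hf n).
have m2 : measurable_fun I2pi (EFin \o f) by apply/measurable_EFinP.
have m3 : {ae mu, forall t, I2pi t -> (fun n => (EFin \o f_ n) t) @ \oo --> (EFin \o f) t}.
  apply: (@filterS _ _ (ae_filter_ringOfSetsType mu) _ _ _ hc) => t ht /= It.
  apply: cvg_EFin; first exact: nearW.
  by apply: ht; move: It; rewrite /= in_itv.
have m4 : {ae mu, forall t, forall n, I2pi t -> (`|(EFin \o f_ n) t| <= (EFin \o g) t)%E}.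
  by apply: aeW => t n _ /=; rewrite lee_fin.
have mI : measurable I2pi by [].
have [i1 _ i2] := @dominated_convergence _ _ _ mu I2pi mI
  (fun n => EFin \o f_ n) (EFin \o f) (EFin \o g) m1 m2 m3 hg m4.
split; first exact: i1.
rewrite /mean; apply: cvgM; first exact: cvg_cst.
rewrite /Rintegral; apply: fine_cvg; rewrite fineK //.
exact: integrable_fin_num.
Qed.

(** Subharmonicity is at hand for polynomials only, so [b] is replaced by Taylor polynomials [P n]
    of its dilates, with an error at most [harmonic n] on the closed disc. On the circle their
    moduli tend almost everywhere to [1 / |gb t|], as [|b| = 1 / |G|] inside, and dominated
    convergence concludes. The limit is written with [expR] and [ln] so that it lies between 0 and 1
    for every [t] and inherits measurability from the logarithm. *)
Lemma boundary_poisson (a b : nat -> C) (G : C -> C) (gb : R -> C) z :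
  bdisc a -> (forall w, cabs w < 1 -> ev a w = G w) ->
  Hinf_le 1 b -> (forall w, cabs w < 1 -> ev b w * ev a w = 1) ->
  is_boundary_value G gb ->
  {ae mu, forall t, 0 <= t <= 2 * pi -> 1 < cabs (gb t)} ->
  measurable_fun I2pi (fun t => ln (cabs (gb t) - 1)) ->
  cabs z < 1 ->
  L1 (fun t => (1 + expR (ln (cabs (gb t) - 1)))^-1) /\
  cabs (ev b z) <=
    mean (fun t => (1 + expR (ln (cabs (gb t) - 1)))^-1 * poisson z t).
Proof.
move=> ha aG hb1 bE hbv h1 ml z1.
set chi := fun t => (1 + expR (ln (cabs (gb t) - 1)))^-1.
have mchi : measurable_fun I2pi chi.
  have mg : measurable_fun [set: R] (fun x : R => (1 + expR x)^-1).
    apply: continuous_measurable_fun => x; apply: cvgV.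
      by rewrite lt0r_neq0 // ltr_pwDl // expR_ge0.
    by apply: cvgD; [exact: cvg_cst | exact: continuous_expR].
  exact: measurableT_comp mg ml.
have chi1 t : `|chi t| <= 1.
  rewrite ger0_norm /chi ?invr_ge0 ?addr_ge0 ?expR_ge0 //.
  by rewrite invf_le1 ?lerDl ?expR_ge0 // ltr_pwDl // expR_ge0.
have L1c (c : R) : L1 (fun=> c) by apply: L1_cont => t; apply: cvg_cst.
have L1chi : L1 chi by apply: L1_le (L1c 1) chi1.
split=> //.
have /choice [N hN] : forall n, exists N, forall w, cabs w <= 1 ->
    cabs (ev b (Complex (rad R n) 0 * w) -
      \sum_(k < N) b k * (Complex (rad R n) 0) ^+ k * w ^+ k) <= harmonic n.
  move=> n; have hs := summable_disc hb1.1 (rad01 R n).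
  have hpos : 0 < harmonic n :> R by rewrite /harmonic /= invr_gt0 ltr0n.
  have [N hN] := tail_small hs hpos; exists N => w w1.
  have /andP[r0 r1] := rad01 R n.
  have hw : cabs (Complex (rad R n) 0 * w) <= rad R n.
    by rewrite cabsM cabs_realc // ler_piMr.
  have := csum_tail N (bdisc_dominated hb1.1 hw r1).
  under eq_bigr => k _ do rewrite exprMn mulrA.
  by move=> h; apply: le_trans h (ltW hN).
pose p n k := b k * (Complex (rad R n) 0) ^+ k.
pose P n w := \sum_(k < N n) p n k * w ^+ k.
have hr n w : cabs w <= 1 -> cabs (Complex (rad R n) 0 * w) < 1.
  have /andP[r0 r1] := rad01 R n; move=> w1.
  by apply: le_lt_trans r1; rewrite cabsM cabs_realc // ler_piMr.
have Pb n w : cabs w <= 1 -> cabs (P n w) <= 2.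
  move=> w1; have h := hN n w w1; have h2 := hb1.2 _ (hr n w w1).
  have h3 : harmonic n <= 1 :> R by rewrite /harmonic /= invf_le1 // ler1n.
  have := cabs_triangle (P n w) 0 (ev b (Complex (rad R n) 0 * w)).
  rewrite !subr0 (cabsBC (P n w)) => h4; apply: le_trans h4 _.
  apply: le_trans (lerD h h2) _; apply: le_trans (lerD h3 (lexx _)) _.
  by rewrite -(natrD R 1 1).
have Plim w l : cabs w <= 1 -> Clim \oo (fun n => ev b (Complex (rad R n) 0 * w)) l ->
    Clim \oo (fun n => P n w) l.
  move=> w1 hl.
  have d0 : Clim \oo (fun n => P n w - ev b (Complex (rad R n) 0 * w)) 0.
    apply/Clim_cabs; apply: (@squeeze0 _ _ _ _ (@harmonic R)); last exact: cvg_harmonic.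
    by move=> n; rewrite subr0 cabs_ge0 cabsBC hN.
  pose proof (ClimD d0 hl) as s; rewrite add0r in s.
  have -> : (fun n => P n w) = fun n => P n w - ev b (Complex (rad R n) 0 * w) +
      ev b (Complex (rad R n) 0 * w) by apply/funext => n; rewrite subrK.
  exact: s.
have L1P n : L1 (fun t => cabs (P n (expi t))) := L1_cabs_poly (N n) (p n).
have Lpoi : L1 (poisson z) by apply: L1_cont; apply: continuous_poisson.
have ineq n : cabs (P n z) <= mean (fun t => cabs (P n (expi t)) * poisson z t).
  exact: (poly_poisson_le (N n) (p n) z1).
have [_ lim] : L1 (fun t => chi t * poisson z t) /\
    (fun n => mean (fun t => cabs (P n (expi t)) * poisson z t)) @ \oo -->
    mean (fun t => chi t * poisson z t).
  apply: (@mean_dominated _ _ (fun t => 2 * poisson z t)).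
  - by move=> n; apply: L1_poisson.
  - apply: measurable_funM => //; apply: measurable_funTS.
    by apply: continuous_measurable_fun; apply: continuous_poisson.
  - exact: L1Z.
  - have hbv' : {ae mu, forall t, (fun r : R => cabs (G (Complex r 0 * expi t) - gb t)) @
        at_left 1 --> (0 : R)} := hbv.
    apply: (@filterS2 _ _ (ae_filter_ringOfSetsType mu) _ _ _ _ hbv' h1) => t ht1 ht2 /ht2 ht3.
    apply: cvgM; last exact: cvg_cst.
    have GL : Clim \oo (fun n => G (Complex (rad R n) 0 * expi t)) (gb t).
      apply/Clim_cabs; move/cvg_at_leftP : ht1; apply; split; last exact: rad_cvg.
      by move=> n; have /andP[] := rad01 R n.
    have e1 : cabs (expi t : C) <= 1 by rewrite cabs_expi.
    have bl : (fun n => cabs (ev b (Complex (rad R n) 0 * expi t))) @ \oo --> chi t.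
      have -> : chi t = (cabs (gb t))^-1.
        rewrite /chi lnK ?posrE ?subr_gt0 //; congr (_^-1); ring.
      have -> : (fun n => cabs (ev b (Complex (rad R n) 0 * expi t))) =
          fun n => (cabs (G (Complex (rad R n) 0 * expi t)))^-1.
        apply/funext => n; have e := bE _ (hr n _ e1); rewrite aG ?hr // in e.
        have /eqP := congr1 (@cabs R) e; rewrite cabsM cabs1 => /eqP e'.
        have g0 : cabs (G (Complex (rad R n) 0 * expi t)) != 0.
          by apply/eqP => h0; move: e'; rewrite h0 mulr0 => /eqP; rewrite eq_sym oner_eq0.
        by apply: (mulIf g0); rewrite e' mulVf.
      apply: cvgV; last exact: Clim_norm.
      by rewrite lt0r_neq0 // (lt_trans ltr01).
    have dist : (fun n => cabs (P n (expi t)) - cabs (ev b (Complex (rad R n) 0 * expi t)))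
        @ \oo --> (0 : R).
      apply/norm_cvg0P; apply: (@squeeze0 _ _ _ _ (@harmonic R)); last exact: cvg_harmonic.
      move=> n; rewrite normr_ge0 /=; apply: le_trans (cabs_dist _ _) _.
      by rewrite cabsBC hN.
    have s : (fun n => cabs (P n (expi t)) - cabs (ev b (Complex (rad R n) 0 * expi t)) +
       cabs (ev b (Complex (rad R n) 0 * expi t))) @ \oo --> 0 + chi t by exact: cvgD.
    rewrite add0r in s.
    have -> : (fun n => cabs (P n (expi t))) = fun n => cabs (P n (expi t)) -
        cabs (ev b (Complex (rad R n) 0 * expi t)) +
        cabs (ev b (Complex (rad R n) 0 * expi t)) by apply/funext => n; rewrite subrK.
    exact: s.
  - move=> n t; rewrite normrM (ger0_norm (cabs_ge0 _)) ger0_norm ?poisson_ge0 //.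
    by rewrite ler_wpM2r ?poisson_ge0 // Pb // cabs_expi.
have hz : Clim \oo (fun n => P n z) (ev b z).
  apply: Plim; first exact: ltW.
  have -> : ev b z = ev b (Complex 1 0 * z) by rewrite -[z in LHS]mul1r.
  by apply: ev_dilate_cvg => //; [exact: hb1.1 | exact: rad_le1 | exact: rad_cvg].
by apply: (ler_cvg_to (Clim_norm hz) lim); apply: nearW.
Qed.

(** Taylor coefficients of the Herglotz transform, the mean of [phi] against
    [(e^it + z) / (e^it - z)]: the mean of [phi] at [k = 0], and twice the [k]-th Fourier
    coefficient afterwards. *)
Definition moment (phi : R -> R) (k : nat) : C :=
  (if k == 0%N then 1 else 2) *
  Complex (mean (fun t => complex.Re (conjc (expi t ^+ k)) * phi t))
          (mean (fun t => complex.Im (conjc (expi t ^+ k)) * phi t)).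

Lemma moment_L1 phi (c : C) k : L1 phi ->
  L1 (fun t => complex.Re (c * conjc (expi t ^+ k)) * phi t) /\
  mean (fun t => complex.Re (c * conjc (expi t ^+ k)) * phi t) =
  complex.Re (c * Complex (mean (fun t => complex.Re (conjc (expi t ^+ k)) * phi t))
          (mean (fun t => complex.Im (conjc (expi t ^+ k)) * phi t))).
Proof.
move=> hp.
have ct (d : C) : continuous (fun t : R => complex.Re (d * conjc (expi t ^+ k))).
  have := @continuous_trig R d (0%:R - k%:R).
  by under eq_fun do rewrite -expi_freq expr0 mul1r.
have L d : L1 (fun t => complex.Re (d * conjc (expi t ^+ k)) * phi t).
  exact: L1_mulc.
have E1 : (fun t : R => complex.Re (conjc (expi t ^+ k)) * phi t) =
    fun t => complex.Re (1 * conjc (expi t ^+ k)) * phi t.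
  by apply/funext => t; rewrite mul1r.
have E2 : (fun t : R => complex.Im (conjc (expi t ^+ k)) * phi t) =
    fun t => complex.Re (- 'i%C * conjc (expi t ^+ k)) * phi t.
  by apply/funext => t; rewrite [in RHS]ReM /= oppr0 mul0r sub0r mulN1r opprK.
split; first exact: L.
rewrite ReM /= E1 E2 -!meanZ; try exact: L.
rewrite -mulN1r -meanZ; last by apply: L1Z; exact: L.
rewrite -meanD; [| by apply: L1Z; exact: L | by apply: L1Z; apply: L1Z; exact: L].
congr mean; apply/funext => t; rewrite mul1r !ReM /=; ring.
Qed.

Lemma moment_bound phi k : L1 phi -> (forall t, 0 <= phi t) ->
  cabs (moment phi k) <= 4 * mean phi.
Proof.
move=> hp p0; rewrite /moment cabsM.
have [c c1 e] := rotate_to_norm (Complex (mean (fun t => complex.Re (conjc (expi t ^+ k)) * phi t))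
          (mean (fun t => complex.Im (conjc (expi t ^+ k)) * phi t))).
have m0 : 0 <= mean phi by apply: mean_ge0.
have [L1c Ec] := moment_L1 c k hp.
have h2 : cabs (if k == 0%N then 1 else 2 : C) <= 2.
  by case: ifP => _; [rewrite cabs1 ler1n | rewrite (cabs_nat R 2)].
have h1 : mean (fun t => complex.Re (c * conjc (expi t ^+ k)) * phi t) <= mean phi.
  apply: mean_le => // t; rewrite ler_piMl // (le_trans (ler_Re_cabs _)) //.
  by rewrite cabsM c1 cabs_conj cabsX cabs_expi expr1n mulr1.
rewrite -e -Ec; apply: (@le_trans _ _ (2 * mean phi)); last by rewrite ler_wpM2r // ler_nat.
apply: (@le_trans _ _ (2 * mean (fun t => complex.Re (c * conjc (expi t ^+ k)) * phi t))).
  by rewrite ler_wpM2r // Ec e cabs_ge0.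
by rewrite ler_wpM2l.
Qed.

(** The real part follows by matching partial sums of the series with the truncated kernels. The
    modulus estimate also controls the imaginary part, which is needed for the outer functions to
    approach 1. *)
Lemma herglotz phi z : L1 phi -> (forall t, 0 <= phi t) -> cabs z < 1 ->
  [/\ bdisc (moment phi),
      complex.Re (ev (moment phi) z) = mean (fun t => phi t * poisson z t) &
      cabs (ev (moment phi) z) <= 4 * mean phi / (1 - cabs z)].
Proof.
move=> hp p0 z1.
have b : bdisc (moment phi).
  move=> r /andP[r0 r1]; exists (4 * mean phi) => k; rewrite -[leRHS]mulr1.
  apply: ler_pM; rewrite ?cabs_ge0 ?exprn_ge0 //; first exact: moment_bound.
  by rewrite exprn_ile1 // ltW.
split=> //.
  apply/esym; apply: mean_poisson_unique => //.
  have [h _] := ev_cvg b z1.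
  pose s (n : nat) := complex.Re (\sum_(k < n) moment phi k * z ^+ k).
  have -> : (fun N => mean (fun t => phi t * poisson_trunc z N t)) = (fun N => s N.+1).
    apply/funext => N; rewrite /s big_ord_recl ReD Re_sum.
    have E t : phi t * poisson_trunc z N t = complex.Re (1 * conjc (expi t ^+ 0)) * phi t +
       \sum_(j < N) complex.Re (2 * z ^+ j.+1 * conjc (expi t ^+ j.+1)) * phi t.
      rewrite poisson_trunc_real mulrC mulrDl expr0 conjc1 mulr1 mulr_suml.
      by congr (_ + _); apply: eq_bigr => j _; rewrite mul1r.
    under eq_fun do rewrite E.
    have [s1 s2] := mean_sum N (fun j => (moment_L1 (2 * z ^+ j.+1) j.+1 hp).1).
    rewrite meanD ?s2 ?(moment_L1 _ _ hp).2 //; last exact: (moment_L1 _ _ hp).1.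
    congr (_ + _); first by rewrite [X in _ = complex.Re X]mulr1.
    apply: eq_bigr => j _.
    by rewrite (moment_L1 _ _ hp).2 mulrAC.
  by rewrite (cvg_shiftS s).
have d : dominated (fun k => moment phi k * z ^+ k) (geometric (4 * mean phi) (cabs z)).
  split=> [k|]; last by apply: is_cvg_geometric_series; rewrite ger0_norm ?cabs_ge0.
  by rewrite cabsM cabsX /geometric /= ler_wpM2r ?exprn_ge0 ?cabs_ge0 // moment_bound.
have := cabs_csum d; rewrite (cvg_lim _ (cvg_geometric_series _)) //.
by rewrite ger0_norm ?cabs_ge0.
Qed.
End BoundaryValues.

(** * The outer factor and the choice of digits *)

Section OuterFunctions.
Variable R : realType.
Local Notation C := R[i].
Local Notation I2pi := (`[0, 2 * pi]%classic : set R).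
Implicit Types (z : C) (t : R) (n k : nat).

Variables (lam : R -> R) (b : nat -> C).
Hypothesis hlam : L1 lam.
Let chi t : R := (1 + expR (lam t))^-1.
Hypotheses (L1chi : L1 chi)
  (b_le : forall z, cabs z < 1 -> cabs (ev b z) <= mean (fun t => chi t * poisson z t)).

(* Up to the truncation at height [n], this is [- 4 log (1 - chi)]. *)
Let phi n t : R := Num.max (4 * ln (1 + expR (- lam t)) - n%:R) 0.

Let phi_ge0 n t : 0 <= phi n t.
Proof. by rewrite le_max lexx orbT. Qed.

Let lnp_ge0 t : 0 <= ln (1 + expR (- lam t)).
Proof. by rewrite ln_ge0 // lerDl expR_ge0. Qed.

(** Here the integrability of [log(|g| - 1)] takes effect: [lam] controls [- log (1 - chi)], because
    [1 + e^(-s) <= 2 e^|s| <= e^(1+|s|)]. *)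
Let lnp_le t : ln (1 + expR (- lam t)) <= 1 + `|lam t|.
Proof.
rewrite -ler_expR lnK ?posrE ?ltr_pwDl ?expR_ge0 // expRD.
have h1 : expR (- lam t) <= expR `|lam t| by rewrite ler_expR -normrN ler_norm.
have h2 : 1 <= expR `|lam t| by rewrite -[leLHS]expR0 ler_expR.
have h3 : 2 <= expR 1 :> R by have := @expR_ge1Dx R 1; rewrite -(natrD R 1 1).
have h4 : 2 * expR `|lam t| <= expR 1 * expR `|lam t| by rewrite ler_wpM2r // expR_ge0.
lra.
Qed.

Let phi_le n t : `|phi n t| <= 4 * (1 + `|lam t|).
Proof.
rewrite ger0_norm // ge_max; apply/andP; split; last by rewrite mulr_ge0 // addr_ge0.
apply: (@le_trans _ _ (4 * ln (1 + expR (- lam t)))); first by rewrite gerBl.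
by rewrite ler_wpM2l.
Qed.

Let L1bound : L1 (fun t => 4 * (1 + `|lam t|)).
Proof.
apply: L1Z; apply: L1D; last exact: L1_norm.
by apply: L1_cont => t; apply: cvg_cst.
Qed.

Let mphi n : measurable_fun I2pi (phi n).
Proof.
have ml : measurable_fun I2pi lam by apply/measurable_EFinP; exact: measurable_int hlam.
have mg : measurable_fun [set: R] (fun x : R => ln (1 + expR (- x))).
  apply: continuous_measurable_fun => x; apply: continuous_comp.
    apply: cvgD; first exact: cvg_cst.
    by apply: continuous_comp; [apply: cvgN; apply: cvg_id | apply: continuous_expR].
  by apply: continuous_ln; rewrite ltr_pwDl // expR_ge0.
apply: measurable_maxr; last exact: measurable_cst.
apply: measurable_funB; last exact: measurable_cst.
apply: measurable_funM; first exact: measurable_cst.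
exact: measurableT_comp mg ml.
Qed.

Let L1phi n : L1 (phi n).
Proof. exact: L1_le (mphi n) L1bound (phi_le n). Qed.

(** For fixed [t] the truncation vanishes as soon as [n] exceeds the height, and the majorant does
    not depend on [n]. *)
Let mean_phi0 : (fun n => mean (phi n)) @ \oo --> (0 : R).
Proof.
have L0 : measurable_fun I2pi (fun=> 0 : R) by exact: measurable_cst.
have hae : {ae @lebesgue_measure R, forall t, 0 <= t <= 2 * pi ->
    (fun n => phi n t) @ \oo --> (0 : R)}.
  apply: aeW => t _; apply/cvgrPdist_lt => e e0.
  exists (Num.bound (4 * ln (1 + expR (- lam t)))) => // n /= hn.
  suff -> : phi n t = 0 by rewrite subrr normr0.
  apply/eqP; rewrite eq_le phi_ge0 andbT ge_max lexx andbT subr_le0.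
  apply: (@le_trans _ _ (Num.bound (4 * ln (1 + expR (- lam t))))%:R); last by rewrite ler_nat.
  by apply/ltW/archi_boundP; rewrite mulr_ge0.
have [_] := mean_dominated L1phi L0 L1bound hae phi_le.
by rewrite mean_cst.
Qed.

(* Jensen's inequality for the Poisson average of [ln (1 - chi)], in the form of the
   tangent line bound [ln y <= y / c - 1 + ln c] with [c = 4 / (k + 1)]. *)
Let phi_tangent n k t :
  4 * (1 - ln (4 / k.+1%:R)) - n%:R - k.+1%:R + k.+1%:R * chi t <= phi n t.
Proof.
rewrite le_max; apply/orP; left.
have k0 : 0 < k.+1%:R :> R by rewrite ltr0n.
have c0 : 0 < 4 / k.+1%:R :> R by rewrite divr_gt0.
set c := 4 / k.+1%:R in c0 *.
have e0 := expR_gt0 (lam t); have e1 : expR (- lam t) = (expR (lam t))^-1 by rewrite expRN.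
set y := (1 + expR (- lam t))^-1.
have y0 : 0 < y by rewrite invr_gt0 ltr_pwDl // expR_ge0.
have yE : y = 1 - chi t.
  by rewrite /y /chi e1; field; rewrite !lt0r_neq0 // ?addr_gt0 // ltr_pwDl.
have -> : ln (1 + expR (- lam t)) = - ln y.
  by rewrite /y lnV ?opprK // posrE ltr_pwDl // expR_ge0.
have h : ln y <= y / c - 1 + ln c.
  have -> : ln y = ln (1 + (y / c - 1)) + ln c.
    have -> : 1 + (y / c - 1) = y / c by rewrite addrC subrK.
    by rewrite -lnM ?posrE ?divr_gt0 // divfK // lt0r_neq0.
  rewrite lerD2r; apply: le_ln1Dx; rewrite ltrBrDl subrr divr_gt0 //.
have e4 : 4 * (y / c) = k.+1%:R * (1 - chi t).
  by rewrite -yE /c; field; rewrite lt0r_neq0.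
have p4 : 0 <= 4 :> R by [].
have h4 := ler_wpM2l p4 h.
rewrite mulrDr mulrBr e4 in h4; lra.
Qed.

Let mean_phi_lower n k z : cabs z < 1 ->
  4 * (1 - ln (4 / k.+1%:R)) - n%:R - k.+1%:R * (1 - cabs (ev b z)) <=
  mean (fun t => phi n t * poisson z t).
Proof.
move=> z1; set A := 4 * _ - _.
have Lp : L1 (poisson z) by apply: L1_cont; apply: continuous_poisson.
have Lc := L1_poisson z1 L1chi.
apply: (@le_trans _ _ (mean (fun t => (A - k.+1%:R) * poisson z t +
    k.+1%:R * (chi t * poisson z t)))).
  rewrite meanD; [|exact: L1Z|exact: L1Z].
  rewrite (meanZ _ Lp) (meanZ _ Lc) mean_poisson1 // mulr1 mulrBr mulr1.
  have k0 : 0 <= k.+1%:R :> R by [].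
  have -> : A - (k.+1%:R - k.+1%:R * cabs (ev b z)) =
    A - k.+1%:R + k.+1%:R * cabs (ev b z) by ring.
  by rewrite lerD2l ler_wpM2l // b_le.
apply: mean_le; [by apply: L1D; apply: L1Z | exact: L1_poisson |].
move=> t; rewrite mulrA -mulrDl ler_wpM2r ?poisson_ge0 //; exact: phi_tangent.
Qed.

(** The tangent bound contributes [exp ((k+1)(1-|b|))] to the estimate of [h n], while
    [|b|^k <= exp (-k(1-|b|))]. Their product is at most [e], which the factor [e^-4] of the tangent
    bound absorbs. What is left is [(4/(k+1))^4], whence 256, times the price [e^n] of the
    truncation, which does not depend on [k]. *)
Lemma outer_family : exists h : nat -> nat -> C,
  [/\ forall n, Hinf_le 1 (h n),
      forall n k z, cabs z < 1 -> cabs (ev b z) ^+ k * cabs (ev (h n) z) <=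
        expR n%:R * 256 / k.+1%:R ^+ 4 &
      forall z, cabs z < 1 -> Clim \oo (fun n => ev (h n) z) 1].
Proof.
have hq n z : cabs z < 1 -> _ := @herglotz _ (phi n) z (L1phi n) (phi_ge0 n).
have z0 : cabs (0 : C) < 1 by rewrite cabs0.
have Qb n : bdisc (moment (phi n)) by have [] := hq n 0 z0.
have Q0 n z : cabs z < 1 -> 0 <= complex.Re (ev (moment (phi n)) z).
  move=> z1; have [_ -> _] := hq n z z1; apply: mean_ge0 => t.
  by rewrite mulr_ge0 // poisson_ge0.
have /choice [h hh] := fun n => exp_series (Qb n) (Q0 n).
exists h; split.
- move=> n; split; first exact: (hh n).1.
  move=> z z1; apply: le_trans (((hh n).2 z z1).1) _.
  by rewrite -[leRHS]expR0 ler_expR oppr_le0 Q0.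
- move=> n k z z1; set be := cabs (ev b z).
  have be0 : 0 <= be by rewrite cabs_ge0.
  have h1 : be ^+ k <= expR (k%:R * (be - 1)).
    rewrite expRM_natl lerXn2r ?nnegrE ?expR_ge0 //.
    by have := expR_ge1Dx (be - 1); rewrite addrC subrK.
  have h2 : cabs (ev (h n) z) <= expR (- (4 * (1 - ln (4 / k.+1%:R)) - n%:R -
      k.+1%:R * (1 - be))).
    apply: le_trans (((hh n).2 z z1).1) _; rewrite ler_expR lerN2.
    by have [_ -> _] := hq n z z1; apply: mean_phi_lower.
  apply: (le_trans (ler_pM _ _ h1 h2)); rewrite ?exprn_ge0 ?cabs_ge0 //.
  have c0 : 0 < 4 / k.+1%:R :> R by rewrite divr_gt0.
  have -> : expR n%:R * 256 / k.+1%:R ^+ 4 = expR (n%:R + 4 * ln (4 / k.+1%:R)) :> R.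
    rewrite expRD expRM_natl lnK ?posrE // expr_div_n -mulrA; congr (_ * (_ / _)).
    by rewrite -natrX.
  rewrite -expRD ler_expR -natr1.
  have : 0 <= be by []. move: (ln _) => L hbe; lra.
move=> z z1; apply/Clim_cabs.
have l1 : (fun n => 4 * mean (phi n) / (1 - cabs z)) @ \oo --> 4 * 0 / (1 - cabs z).
  by apply: cvgM; [apply: cvgM => //; exact: cvg_cst | exact: cvg_cst].
rewrite mulr0 mul0r in l1.
have l2 : (fun n => expR (4 * mean (phi n) / (1 - cabs z))) @ \oo --> (expR 0 : R).
  by apply: continuous_cvg l1; exact: continuous_expR.
rewrite expR0 in l2.
have lim : (fun n => expR (4 * mean (phi n) / (1 - cabs z)) - 1) @ \oo --> (1 - 1 : R).
  by apply: cvgB; [exact: l2 | exact: cvg_cst].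
rewrite subrr in lim.
apply: (squeeze0 _ lim) => n; rewrite cabs_ge0 /=.
apply: le_trans (((hh n).2 z z1).2) _; rewrite lerD2r ler_expR.
by have [] := hq n z z1.
Qed.
End OuterFunctions.

(** * The counting argument *)

Section Selection.
Variable R : realType.
Local Notation C := R[i].

(** The deficit [1 / (N+1)] is what leaves a good tuple in the count, for every [N]. *)
Lemma sum_inv_pronic N : \sum_(k < N) (k.+1 * k.+2)%:R^-1 = 1 - N.+1%:R^-1 :> R.
Proof.
elim: N => [|N IH]; first by rewrite big_ord0 invr1 subrr.
rewrite big_ord_recr /= IH natrM.
have h (i : nat) : i.+1%:R != 0 :> R by rewrite pnatr_eq0.
have e : N.+2%:R = N.+1%:R + 1 :> R by rewrite -natr1.
have h2 := h N.+1; rewrite e in h2 *; field.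
by rewrite (addrC 1) natr1 h2 h.
Qed.

Lemma cabs_natB (p q : nat) : p != q -> 1 <= cabs (p%:R - q%:R : C).
Proof.
have h (r s : nat) : (s < r)%N -> 1 <= cabs (r%:R - s%:R : C).
  by move=> sr; rewrite -natrB ?(ltnW sr) // cabs_nat ler1n subn_gt0.
by case: (ltngtP p q) => // [pq _|qp _]; [rewrite cabsBC|]; apply: h.
Qed.

(* For fixed values of the other variables, at most one value of [t m] violates the
   [m]-th inequality, so the tuples violating it make up at most a fraction
   [1 / ((m + 1) (m + 2))] of all tuples, and these fractions add up to less than 1. *)
Lemma exists_avoiding_tuple N (d : nat -> nat -> C) (dl : R) :
  (forall m, (m < N)%N -> dl * 2 <= cabs (d m m)) ->
  exists t : nat -> nat, (forall k, (t k < k.+1 * k.+2)%N) /\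
    forall m, (m < N)%N -> dl <= cabs (\sum_(k < N) (t k)%:R * d m k).
Proof.
move=> hd; pose L (k : nat) := (k.+1 * k.+2)%N.
(* A common upper bound of the ranges, so that tuples form one finite function type; [P] cuts out
   the true ranges. *)
pose W := (N.+1 * N.+2)%N.
have LW (k : 'I_N) : (L k <= W)%N by apply: leq_mul; rewrite ?ltnS ltnW.
pose Tp := {ffun 'I_N -> 'I_W}.
pose P := [set t : Tp | [forall k, t k < L k]%N]%SET.
pose vl (t : Tp) (m : nat) : C := \sum_(k < N) (t k)%:R * d m k.
pose Bad (m : 'I_N) := [set t in P | cabs (vl t m) < dl]%SET.
have W0 : (0 < W)%N by [].
have ltLW (m : 'I_N) (i : 'I_(L m)) : (i < W)%N by apply: leq_trans (LW m).
(* Overwriting the [m]-th digit of a bad tuple by an arbitrary admissible one is injective: the new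
   digit and the other digits can be read off, and the latter determine the only bad [m]-th
   digit. *)
pose upd (m : 'I_N) (ti : Tp * 'I_(L m)) : Tp :=
  [ffun k => if k == m then Ordinal (ltLW m ti.2) else ti.1 k].
have hBad m : (#|Bad m| * L m <= #|P|)%N.
  rewrite -[X in (_ * X)%N]card_ord -cardsT -cardsX.
  rewrite -(@card_in_imset _ _ (upd m)); last first.
    move=> [t i] [s j]; rewrite !inE /= !andbT => /andP[_ ht] /andP[_ hs] e.
    have ek k : (upd m (t, i)) k = (upd m (s, j)) k by rewrite e.
    have ij : i = j.
      by apply: val_inj; have := congr1 (@nat_of_ord _) (ek m); rewrite !ffunE eqxx.
    have off k : k != m -> t k = s k.
      by move=> km; have := ek k; rewrite !ffunE (negbTE km).
    suff tm : t m = s m.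
      congr (_, _) => //; apply/ffunP => k.
      by have [->|/off] := eqVneq k m.
    have diff : vl t m - vl s m = ((t m)%:R - (s m)%:R) * d m m.
      rewrite /vl -sumrB (bigD1 m) //= -mulrBl big1 ?addr0 // => k /off ->.
      by rewrite subrr.
    have small : cabs (vl t m - vl s m) < dl * 2.
      by apply: le_lt_trans (cabsB _ _) _; rewrite mulr_natr mulr2n ltrD.
    apply/eqP; apply: contraTT small => tsm; rewrite -leNgt diff cabsM.
    apply: le_trans (hd m (ltn_ord m)) _; rewrite ler_peMl ?cabs_ge0 //.
    exact: cabs_natB.
  apply: subset_leq_card; apply/fintype.subsetP => _ /imsetP[[t i] ti ->].
  move: ti; rewrite !inE /= andbT => /andP[/forallP ht _].
  apply/forallP => k; rewrite ffunE; case: eqP => [->|_] //=.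
have P0 : (0 < #|P|)%N.
  apply/card_gt0P; exists [ffun=> Ordinal W0]; rewrite inE.
  by apply/forallP => k; rewrite ffunE.
have [t tP tgood] : exists2 t, t \in P & forall m : 'I_N, t \notin Bad m.
  apply: contrapT => hno.
  have cov : (#|P| <= \sum_(m < N) #|Bad m|)%N.
    apply: (@leq_trans #|(\bigcup_(m < N) Bad m)%SET|); last first.
      elim/big_ind2: _ => [|A p B q hA hB|//]; first by rewrite cards0.
      by apply: leq_trans (leq_card_setU p q) _; apply: leq_add.
    apply: subset_leq_card; apply/fintype.subsetP => t tP.
    apply: contrapT => tB; apply: hno; exists t => // m.
    by apply/negP => tm; apply: tB; apply/finset.bigcupP; exists m.
  have : (#|P|%:R : R) <= \sum_(m < N) #|P|%:R * (L m)%:R^-1.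
    apply: (@le_trans _ _ (\sum_(m < N) #|Bad m|)%:R); first by rewrite ler_nat.
    rewrite natr_sum; apply: ler_sum => m _.
    by rewrite ler_pdivlMr ?ltr0n // -natrM ler_nat.
  rewrite -mulr_sumr sum_inv_pronic mulrBr mulr1 leNgt => /negP; apply.
  by rewrite ltrBlDr ltrDl mulr_gt0 ?invr_gt0 ?ltr0n.
pose tt (k : nat) : nat := if insub k is Some i then t i else 0%N.
have ttE (i : 'I_N) : tt i = t i by rewrite /tt valK.
exists tt; split=> [k|m mN].
  rewrite /tt; case: insubP => [i _ <-|_]; last by [].
  by move: tP; rewrite inE => /forallP.
have := tgood (Ordinal mN); rewrite inE tP /= -leNgt /vl.
by under [in X in _ -> X]eq_bigr => k _ do rewrite ttE.
Qed.
End Selection.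

(** * A functional with no small value on the orbit *)

Section Assembly.
Variable R : realType.
Local Notation C := R[i].
Implicit Types (a b f h x y : nat -> C) (z : C).

Lemma Toep_sum N a (c : nat -> C) (f : nat -> nat -> C) m :
  iter m (Toep a) (fun k => \sum_(i < N) c i * f i k) =
  fun k => \sum_(i < N) c i * iter m (Toep a) (f i) k.
Proof.
elim: m => [//|m IH]; rewrite iterS IH; apply/funext => k.
rewrite /Toep; under eq_bigr => j _ do rewrite mulr_sumr.
rewrite exchange_big; apply: eq_bigr => i _; rewrite mulr_sumr /=.
by apply: eq_bigr => j _; rewrite mulrCA.
Qed.

(** From [k + 2 <= 2 (k + 1)]. The right-hand side is shaped for [sum_inv_pronic], which bounds all
    the sums by [4 K]. *)
Lemma term_bound k (n : nat) (K : R) : 0 <= K -> (n < k.+1 * k.+2)%N ->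
  n%:R * (K / k.+1%:R ^+ 4) <= 2 * K * (k.+1 * k.+2)%:R^-1 * 2.
Proof.
move=> K0 nk; have k0 : 0 < k.+1%:R :> R by rewrite ltr0n.
apply: (@le_trans _ _ ((k.+1 * k.+2)%:R * (K / k.+1%:R ^+ 4))).
  by rewrite ler_wpM2r ?ler_nat ?divr_ge0 ?exprn_ge0 // ltnW.
rewrite natrM; have e : k.+2%:R = k.+1%:R + 1 :> R by rewrite -natr1.
have k1 : 1 <= k.+1%:R :> R by rewrite ler1n.
rewrite e; move: (k.+1%:R) k0 k1 => u u0 u1 {e}.
have v0 : 0 < u + 1 by rewrite addr_gt0.
have -> : u * (u + 1) * (K / u ^+ 4) = K * ((u + 1) / u ^+ 3).
  by field; rewrite lt0r_neq0.
have -> : 2 * K * (u * (u + 1))^-1 * 2 = K * (4 / (u * (u + 1))).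
  by field; rewrite !lt0r_neq0.
rewrite ler_wpM2l // ler_pdivrMr ?exprn_gt0 // mulrAC ler_pdivlMr ?mulr_gt0 //.
have -> : (u + 1) * (u * (u + 1)) = u * (u + 1) ^+ 2 by ring.
have -> : 4 * u ^+ 3 = u * (2 * u) ^+ 2 by ring.
rewrite ler_wpM2l ?(ltW u0) // ler_sqr ?nnegrE ?(ltW v0) ?mulr_ge0 ?(ltW u0) //.
lra.
Qed.

(** The digits are chosen anew for each [N], with no compatibility between different [N]. The finite
    sums [f N] stay in one ball of bounded functions, so an ultralimit exists, and each inequality,
    valid for all [N > m], passes to it. *)
Lemma escaping_vector a b h x (M K : R) :
  Hinf_le M a -> Hinf_le 1 b -> (forall z, cabs z < 1 -> ev b z * ev a z = 1) -> Hinf_le 1 h ->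
  (forall k z, cabs z < 1 -> cabs (ev b z) ^+ k * cabs (ev h z) <= K / k.+1%:R ^+ 4) ->
  inH2 x -> ip h x <> 0 ->
  exists f, (exists M', Hinf_le M' f) /\
    exists2 dl : R, 0 < dl & forall m, dl <= cabs (ip (iter m (Toep a) f) x).
Proof.
move=> ha hbb ba hh hK hx hne.
have K0 : 0 <= K.
  have := hK 0%N 0; rewrite cabs0 => /(_ ltr01); rewrite expr0 mul1r expr1n divr1.
  by apply: le_trans; apply: cabs_ge0.
pose F k := iter k (Toep b) h.
have FE k := ev_iter_Toep k hbb.1 hh.1.
have hF k : Hinf_le (K / k.+1%:R ^+ 4) (F k).
  split; first exact: (FE k).1.
  by move=> z z1; rewrite ((FE k).2 z z1) cabsM cabsX; apply: hK.
pose d m k := ip (iter m (Toep a) (F k)) x.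
(* On the diagonal the powers cancel: [g^m b^m h = h]. *)
have dE m : d m m = ip h x.
  rewrite /d; congr (ip _ x); have [p1 p2] := ev_iter_Toep m ha.1 (FE m).1.
  apply: ev_inj => //; first exact: hh.1.
  move=> z z1; rewrite (p2 z z1) ((FE m).2 z z1) mulrA -exprMn.
  by rewrite [ev a z * _]mulrC ba // expr1n mul1r.
pose dl := cabs (ip h x) / 2.
have dl0 : 0 < dl by rewrite divr_gt0 // cabs_gt0 //; apply/eqP.
have /choice [t ht] : forall N, exists t : nat -> nat, (forall k, (t k < k.+1 * k.+2)%N) /\
    forall m, (m < N)%N -> dl <= cabs (\sum_(k < N) (t k)%:R * d m k).
  move=> N; apply: exists_avoiding_tuple => m _.
  by rewrite dE /dl divfK.
pose f N k := \sum_(i < N) ((t N i)%:R : C) * F i k.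
have hf N : Hinf_le (2 * K * 2) (f N).
  have [p1 p2] := ev_sum N (fun i => (t N i)%:R : C) (fun i => (hF i).1).
  split=> // z z1; rewrite (p2 z z1); apply: le_trans (cabs_sum _ _) _.
  apply: (@le_trans _ _ (\sum_(i < N) 2 * K * (i.+1 * i.+2)%:R^-1 * 2)).
    apply: ler_sum => i _; apply: le_trans (term_bound K0 ((ht N).1 i)).
    by rewrite cabsM cabs_nat ler_wpM2l // (hF i).2.
  rewrite -mulr_suml -mulr_sumr sum_inv_pronic ler_wpM2r // ler_piMr ?mulr_ge0 //.
have [U UU oU] := exists_ultra.
have [g [hg1 hg2 _]] := montel UU hf.
exists g; split; first by exists (2 * K * 2).
exists dl => // m.
have hTf N : Hinf_le (M ^+ m * (2 * K * 2)) (iter m (Toep a) (f N)) by apply: Hinf_le_iter_Toep.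
have cT k : Clim U (fun N => iter m (Toep a) (f N) k) (iter m (Toep a) g k).
  by elim: m {hTf} k => [|m IH] k; [exact: hg2 | rewrite iterS; apply: Clim_Toep].
pose proof (ip_lim _ hTf cT hx) as lim.
apply: (ler_cvg_to (cvg_cst dl) (Clim_norm lim)).
apply: (oU (fun N => dl <= cabs (ip (iter m (Toep a) (f N)) x))).
exists m.+1 => // N /= mN.
rewrite (Toep_sum N a (fun i => (t N i)%:R) F m).
rewrite (@ip_sum _ N (fun i => (t N i)%:R) (fun i => iter m (Toep a) (F i)) x) //.
  exact: (ht N).2.
by move=> i; apply: Hinf_le_inH2 (Hinf_le_iter_Toep m ha (hF i)).
Qed.

Lemma inH2_sub x y : inH2 x -> inH2 y -> inH2 (x - y).
Proof.
move=> hx hy; have hc : cvgn (series (fun k => 2 * cabs (x k) ^+ 2 + 2 * cabs (y k) ^+ 2)).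
  by apply/cvg_ex; eexists; apply: series_comb.
apply: series_le_cvg hc => k; rewrite ?sqr_ge0 //.
  by rewrite addr_ge0 // mulr_ge0 // sqr_ge0.
rewrite -[(x - y) k]/(x k - y k).
have h : cabs (x k - y k) ^+ 2 <= (cabs (x k) + cabs (y k)) ^+ 2.
  by rewrite ler_sqr ?nnegrE ?addr_ge0 ?cabs_ge0 // cabsB.
have := sqr_ge0 (cabs (x k) - cabs (y k)).
rewrite sqrrB => h2; apply: le_trans h _; rewrite sqrrD.
move: (cabs (x k) * cabs (y k)) h2 => p h2.
rewrite !mulr2n in h2 *; lra.
Qed.

Lemma ip_functional f y : inH2 f -> inH2 y -> ip y f <> 0 ->
  nonzero_cont_lin_functional (fun x => ip x f).
Proof.
move=> hf hy nz; split; [|split; [|split]].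
- move=> x w hx hw; apply: csum_unique.
  have := cconvD (ip_cvg hx hf) (ip_cvg hw hf).
  by under eq_fun do rewrite -mulrDl.
- move=> c x hx; apply: csum_unique; have := cconvZ c (ip_cvg hx hf).
  by under eq_fun do rewrite mulrA.
- move=> x0 hx0 e e0; pose F := H2norm f ^+ 2 + 1.
  have F0 : 0 < F by rewrite ltr_wpDl ?sqr_ge0.
  have F1 : 1 <= F by rewrite lerDr sqr_ge0.
  (* With the weight [2 F / e] in [ip_bound], the first term is at most [e / (2 F) <= e / 2], and
     the second is strictly below [e / 2] because [F] exceeds the squared norm of [f] by 1. *)
  exists (e / (2 * F)); first by rewrite divr_gt0 ?mulr_gt0.
  move=> x hx hd.
  have -> : ip x f - ip x0 f = ip (x - x0) f.
    apply/esym/csum_unique.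
    have := cconvD (ip_cvg hx hf) (cconvZ (-1) (ip_cvg hx0 hf)); rewrite mulN1r.
    by under eq_fun do rewrite mulN1r -mulrBl.
  have s0 : 0 < 2 * F / e by rewrite divr_gt0 ?mulr_gt0.
  apply: le_lt_trans (ip_bound s0 (inH2_sub hx hx0) hf) _.
  have n0 : 0 <= H2norm (x - x0) by rewrite sqrtr_ge0.
  have h1 : H2norm (x - x0) ^+ 2 <= (e / (2 * F)) ^+ 2.
    by rewrite ler_sqr ?nnegrE ?divr_ge0 ?mulr_ge0 ?(ltW F0) ?(ltW e0) // ltW.
  have h2 : 2 * F / e * H2norm (x - x0) ^+ 2 <= e / 2.
    apply: le_trans (ler_wpM2l (ltW s0) h1) _.
    have -> : 2 * F / e * (e / (2 * F)) ^+ 2 = e / 2 * F^-1.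
      by field; rewrite !lt0r_neq0.
    by rewrite ler_piMr ?divr_ge0 ?(ltW e0) // invf_le1.
  have h3 : (2 * F / e)^-1 * H2norm f ^+ 2 < e / 2.
    have -> : (2 * F / e)^-1 * H2norm f ^+ 2 = e / 2 * (H2norm f ^+ 2 / F).
      by field; rewrite !lt0r_neq0.
    by rewrite gtr_pMr ?divr_gt0 // ltr_pdivrMr // mul1r /F ltrDl.
  have := ler_ltD h2 h3; by rewrite -splitr.
- by exists y.
Qed.

Lemma ip_mono_self (j : nat) : ip (mono R j) (mono R j) = 1.
Proof.
apply: csum_unique; apply/ClimP => e e0; exists j.+1 => // n /= jn.
rewrite (bigD1 (Ordinal jn)) //= /mono eqxx conjc1 mulr1 big1 ?addr0 ?subrr ?cabs0 //.
by move=> i; rewrite -val_eqE /= => /negbTE ->; rewrite mul0r.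
Qed.

Lemma ip_mono_l (j : nat) x : ip (mono R j) x = conjc (x j).
Proof.
apply: csum_unique; apply/ClimP => e e0; exists j.+1 => // n /= jn.
rewrite (bigD1 (Ordinal jn)) //= /mono eqxx mul1r big1 ?addr0 ?subrr ?cabs0 //.
by move=> i; rewrite -val_eqE /= => /negbTE ->; rewrite mul0r.
Qed.

Lemma adjoint_iter a (A : (nat -> C) -> nat -> C) (M M' : R) f x m :
  is_adjoint_on_H2 (Toep a) A -> Hinf_le M a -> Hinf_le M' f -> inH2 x ->
  inH2 (iter m A x) /\ ip f (iter m A x) = ip (iter m (Toep a) f) x.
Proof.
move=> [A1 A2] ha hf hx.
have hA k : inH2 (iter k A x) by elim: k => [//|k IH]; rewrite iterS; apply: A1.
split=> //; elim: m M' f hf => [//|m IH] M' f hf.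
rewrite iterS iterSr -(IH (M * M') (Toep a f)); last exact: Hinf_le_Toep.
have [s [s1 s2]] := A2 f _ (Hinf_le_inH2 hf) (hA m).
by rewrite (ip_unique s1) (ip_unique s2).
Qed.
End Assembly.

Theorem theorem1p10 (R : realType) (a : nat -> R[i]) (G : R[i] -> R[i])
  (gb : R -> R[i]) (A : (nat -> R[i]) -> (nat -> R[i])) :
  is_Hinf a G ->
  is_boundary_value G gb ->
  (forall z, cabs z < 1 -> 1 <= cabs (G z)) ->
  {ae (@lebesgue_measure R), forall t, 0 <= t <= 2 * pi -> 1 < cabs (gb t)} ->
  (@lebesgue_measure R).-integrable `[0, 2 * pi]
     (fun t => (ln (cabs (gb t) - 1))%:E) ->
  is_adjoint_on_H2 (Toep a) A ->
  ~ one_weakly_hypercyclic_H2 A.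
Proof.
move=> [aG [M hM]] hbv G1 gb1 hint hadj [x [hx hyp]].
have [ha1 aE] : bdisc a /\ forall z, cabs z < 1 -> ev a z = G z.
  by apply: bdisc_ev => z z1; apply/CcvgE; apply: aG.
have ha : Hinf_le M a by split=> // z z1; rewrite aE // hM.
have orbit f (M' : R) m : Hinf_le M' f ->
    cabs (ip (iter m A x) f) = cabs (ip (iter m (Toep a) f) x).
  move=> hf; have [h1 h2] := adjoint_iter m hadj ha hf hx.
  by rewrite (ip_conj (Hinf_le_inH2 hf) h1) cabs_conj h2.
(* The orbit of [x = 0] pairs to 0 with the constant function 1 and stays away from the target 1.
   Otherwise a nonzero coefficient gives [<z^j, x> <> 0]. *)
have [[j xj]|x0] := pselect (exists j, x j != 0); last first.
  have hm := @Hinf_le_mono R 0.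
  have nz : ip (mono R 0) (mono R 0) <> 0 :> R[i] by rewrite ip_mono_self; apply/eqP/oner_neq0.
  have half : 0 < 2^-1 :> R by rewrite invr_gt0.
  have [_ [m _ <-]] := hyp _ (ip_functional (Hinf_le_inH2 hm) (Hinf_le_inH2 hm) nz) 1 _ half.
  have -> : ip (iter m A x) (mono R 0) = 0.
    apply: cabs_eq0; rewrite (orbit _ _ m hm).
    have -> : x = fun=> 0.
      by apply/funext => k; apply: contrapT => /eqP h; apply: x0; exists k.
    have -> : ip (iter m (Toep a) (mono R 0)) (fun=> 0) = 0.
      apply: csum_unique; under eq_fun do rewrite conjc0 mulr0; exact: cconv0.
    exact: cabs0.
  by rewrite sub0r cabsN cabs1 ltNge invf_le1 // ler1n.
have a1 z : cabs z < 1 -> 1 <= cabs (ev a z) by move=> z1; rewrite aE // G1.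
have [b [hbb ba]] := inverse_series ha1 a1.
have ml : measurable_fun (`[0, 2 * pi]%classic : set R) (fun t => ln (cabs (gb t) - 1)).
  by apply/measurable_EFinP; exact: measurable_int hint.
have bp z (z1 : cabs z < 1) := boundary_poisson ha1 aE hbb ba hbv gb1 ml z1.
have z0 : cabs (0 : R[i]) < 1 by rewrite cabs0.
have [h [h1 h2 h3]] := @outer_family R (fun t => ln (cabs (gb t) - 1)) b hint
  (bp 0 z0).1 (fun z z1 => (bp z z1).2).
have hj := @Hinf_le_mono R j.
pose hs n := Toep (mono R j) (h n).
have hhs n : Hinf_le 1 (hs n) by rewrite -[1]mulr1; apply: Hinf_le_Toep.
(* Pointwise convergence of [h n] to 1 becomes coefficientwise convergence along [U], so these
   pairings tend to [<z^j, x>], the conjugate of [x j], and cannot all vanish. *)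
have [n hn] : exists n, ip (hs n) x <> 0.
  have [U UU oU] := @exists_ultra.
  have [g [hg1 hg2 hg3]] := montel UU h1.
  have gE : g = mono R 0.
    have [m1 m2] := ev_mono R 0.
    apply: ev_inj => //; first exact: hg1.1.
    move=> z z1; rewrite m2 // expr0; apply: Clim_unique (hg3 z z1) _.
    by apply: Clim_subfilter oU _; exact: h3.
  have lim : Clim U (fun n => ip (hs n) x) (conjc (x j)).
    have -> : conjc (x j) = ip (Toep (mono R j) g) x.
      rewrite -ip_mono_l; congr (ip _ x); rewrite gE.
      have [m1 m2] := ev_mono R 0; have [p1 p2] := ev_mono R j.
      have [q1 q2] := ev_Toep p1 m1; apply: ev_inj => // z z1.
      by rewrite (q2 z z1) (m2 z z1) expr0 mulr1.
    have cT k : Clim U (fun n => hs n k) (Toep (mono R j) g k) by apply: Clim_Toep.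
    exact: (ip_lim _ hhs cT hx).
  apply: contrapT => hno.
  have E : (fun n => ip (hs n) x) = fun=> 0.
    by apply/funext => n; apply: contrapT => hn; apply: hno; exists n.
  rewrite E in lim; pose proof (Clim_unique lim (Clim_cst U 0)) as e0.
  by move/eqP : e0; rewrite conjc_eq0 (negbTE xj).
have hK k z : cabs z < 1 ->
    cabs (ev b z) ^+ k * cabs (ev (hs n) z) <= expR n%:R * 256 / k.+1%:R ^+ 4.
  move=> z1; apply: le_trans (h2 n k z z1); rewrite ler_wpM2l ?exprn_ge0 ?cabs_ge0 //.
  rewrite ((ev_Toep hj.1 (h1 n).1).2 z z1) cabsM.
  by rewrite ler_piMl ?cabs_ge0 // hj.2.
have [f [[M' hf] [dl dl0 hdl]]] := escaping_vector ha hbb ba (hhs n) hK hx hn.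
(* The case [m = 0] of the lower bound shows that the functional is nonzero; its orbit then misses
   the disc of radius [dl] about 0. *)
have nz : ip x f <> 0.
  move=> e; have := orbit f M' 0 hf; rewrite /= e cabs0 => e'.
  by have := hdl 0%N; rewrite /= -e' leNgt dl0.
have [_ [m _ <-]] := hyp _ (ip_functional (Hinf_le_inH2 hf) hx nz) 0 dl dl0.
by rewrite subr0 (orbit _ _ m hf) ltNge hdl.
Qed.
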